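(* Let $m\in\mathbb{N}$ and $f\in L^2(\mathbb{R}^m,\mathrm{C}\ell_m^{\mathbb{R}})$. Then, for each compact set $K\subset\mathbb{C}^m$, $$\sup_{\underline{z}\in K}\left|\sum_{l=0}^\infty\sum_{k=0}^\infty\sum_{j=1}^{\dim(M_l^+(k))}\Psi_{l,k,j}(\underline{z})\,\langle\phi_{l,k,j},f\rangle_{L^2}\right|_0<\infty.$$
   Context: $\mathrm{C}\ell_m^{\mathbb{R}}$ and $\mathrm{C}\ell_m^{\mathbb{C}}$ denote the real and complex Clifford algebras with generators $e_1,\dots,e_m$, relations $e_ie_j+e_je_i=0$ ($i\neq j$), $e_j^2=-1$, and unit $e_0=1$. Every element is $a=\sum_A a_Ae_A$ with $e_A=e_{n_1}\cdots e_{n_l}$ for $A=(n_1<\dots<n_l)$, and $|a|_0=\sqrt{\sum_A|a_A|^2}$. The involution on $\mathrm{C}\ell_m^{\mathbb{R}}$ is $\bar a=\sum_A a_A\bar e_A$ with $\bar e_A=(-1)^{|A|(|A|+1)/2}e_A$. Vectors are identified with Clifford vectors, $\underline{x}=\sum_j x_je_j$, $\underline{z}=\sum_j z_je_j$, and $\underline{z}^{\,l}$ is the $l$-th power in $\mathrm{C}\ell_m^{\mathbb{C}}$. $L^2=L^2(\mathbb{R}^m,\mathrm{C}\ell_m^{\mathbb{R}})$ is the right module of measurable $f=\sum_Af_Ae_A:\mathbb{R}^m\to\mathrm{C}\ell_m^{\mathbb{R}}$ with all $f_A\in L^2(\mathbb{R}^m,\mathbb{R})$, with Clifford-valued inner product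 $\langle f,g\rangle_{L^2}=\int_{\mathbb{R}^m}\overline{f(\underline{x})}g(\underline{x})\,d\underline{x}$. $M_l^+(k)$ (here the subscript $l$ stands for ''left'') is the right $\mathrm{C}\ell_m^{\mathbb{R}}$-module of left inner spherical monogenics of order $k$: $\mathrm{C}\ell_m^{\mathbb{R}}$-valued homogeneous polynomials $P_k$ of degree $k$ on $\mathbb{R}^m$ with $D_{\underline{x}}P_k=0$, $D_{\underline{x}}=\sum_{j=1}^me_j\partial_{x_j}$. Its dimension is $\binom{m+k-2}{k}$ (and $1$ for $k=0$). For each $k\in\mathbb{N}_0$, $\{P_k^{(j)}\}_{j=1,\dots,\dim(M_l^+(k))}$ is a fixed orthonormal basis of $M_l^+(k)$ with respect to the Clifford-valued inner product $\frac1{A_m}\int_{S^{m-1}}\overline{P}\,Q\,dS$, $A_m=2\pi^{m/2}/\Gamma(m/2)$. $P_k(\underline{z})$ is obtained by replacing $x_j$ by $z_j$. The generalized Clifford Hermite polynomials are given by $H_{l,m,k}(\underline{x})P_k(\underline{x})=e^{|\underline{x}|^2/2}(-1)^lD_{\underline{x}}^l\big(e^{-|\underline{x}|^2/2}P_k(\underline{x})\big)$ for every $P_k\in M_l^+(k)$, and the constants are $$\gamma_{2p,k}=\frac{2^{2p+m/2+k}\,p!\,\sqrt{\pi}^{\,m}\,\Gamma(\frac m2+k+p)}{\Gamma(\frac m2)},\qquad \gamma_{2p+1,k}=\frac{2^{2p+m/2+k+1}\,p!\,\sqrt{\pi}^{\,m}\,\Gamma(\frac m2+k+p+1)}{\Gamma(\frac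 m2)}\qquad (p,k\in\mathbb{N}_0).$$ Finally, for $l,k\in\mathbb{N}_0$ and $1\le j\le\dim(M_l^+(k))$, $$\phi_{l,k,j}(\underline{x})=\frac{1}{\sqrt{\gamma_{l,k}}}H_{l,m,k}(\underline{x})P_k^{(j)}(\underline{x})e^{-\frac{|\underline{x}|^2}{4}},\qquad \Psi_{l,k,j}(\underline{z})=\frac{1}{\sqrt{\gamma_{l,k}}}\,\underline{z}^{\,l}P_k^{(j)}(\underline{z}).$$ The functions $\phi_{l,k,j}$ form an orthonormal basis of $L^2(\mathbb{R}^m,\mathrm{C}\ell_m^{\mathbb{R}})$. *)

(* Defs.v *)
From HB Require Import structures.
From mathcomp Require Import all_boot all_order all_algebra.
From mathcomp Require mpoly.
Import -(notations) mpoly.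
From mathcomp Require Import all_classical all_reals all_analysis.
From mathcomp Require Import measurable_realfun complex.

Set Implicit Arguments.
Unset Strict Implicit.
Unset Printing Implicit Defensive.

Import Order.TTheory GRing.Theory Num.Theory.
Import numFieldNormedType.Exports.

Local Open Scope ring_scope.

(* The Clifford algebra on e_1, ..., e_m with e_j^2 = -1.  An element is the  *)
(* family of its coefficients on the basis e_A, A a set of indices, and        *)
(* e_A e_B = (-1)^N e_(A symdiff B), where N is the number of pairs (a, b) in  *)
(* A x B with b <= a: the transpositions needed to sort the word (b < a) plus  *)
(* the relations e_a^2 = -1 (b = a).  The defining relations are clgen_sqr and *)
(* clgen_anticomm, and blade_prod is e_A = e_(n_1) ... e_(n_l).                *)

Definition symdiff (m : nat) (A B : {set 'I_m}) : {set 'I_m} :=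
  [set i | (i \in A) (+) (i \in B)].

Definition blade_inv (m : nat) (A B : {set 'I_m}) : nat :=
  (\sum_(a in A) \sum_(b in B) (b <= a))%N.

Definition clifford (F : Type) (m : nat) : Type := {ffun {set 'I_m} -> F}.

Section CliffordRing.
Variables (F : comNzRingType) (m : nat).
Local Notation Cl := (clifford F m).

HB.instance Definition _ := GRing.Lmodule.copy Cl {ffun {set 'I_m} -> F^o}.

Definition mkcl (g : {set 'I_m} -> F) : Cl := [ffun A => g A].

Definition blade (A : {set 'I_m}) : Cl := mkcl (fun B => (B == A)%:R).

Definition clmul (a b : Cl) : Cl :=
  \sum_(A : {set 'I_m}) \sum_(B : {set 'I_m})
    (a A * b B * (-1) ^+ blade_inv A B) *: blade (symdiff A B).

Lemma clP (a b : Cl) : (forall A, a A = b A) -> a = b.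
Proof. by move=> ab; apply/ffunP. Qed.

Lemma mkclE g A : mkcl g A = g A.
Proof. by rewrite ffunE. Qed.

Lemma clcoefD (a b : Cl) A : (a + b) A = a A + b A.
Proof. by rewrite ffunE. Qed.

Lemma clcoefZ x (a : Cl) A : (x *: a) A = x * a A.
Proof. by rewrite ffunE. Qed.

Lemma clcoef0 A : (0 : Cl) A = 0.
Proof. by rewrite ffunE. Qed.

Lemma clcoefN (a : Cl) A : (- a) A = - a A.
Proof. by rewrite ffunE. Qed.

Lemma clcoef_sum I (r : seq I) (P : pred I) (G : I -> Cl) A :
  (\sum_(i <- r | P i) G i) A = \sum_(i <- r | P i) G i A.
Proof.
exact: (big_morph (fun a : Cl => a A) (fun a b => clcoefD a b A) (clcoef0 A)).
Qed.

Lemma cl_blades (a : Cl) : a = \sum_A a A *: blade A.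
Proof.
apply: clP => A. rewrite clcoef_sum (bigD1 A) //= clcoefZ mkclE eqxx mulr1.
by rewrite big1 ?addr0 // => B nBA; rewrite clcoefZ mkclE eq_sym (negbTE nBA) mulr0.
Qed.

Lemma clmulDl : left_distributive clmul +%R.
Proof.
move=> a b c; rewrite /clmul -big_split; apply: eq_bigr => A _ /=.
rewrite -big_split; apply: eq_bigr => B _ /=.
by rewrite clcoefD !mulrDl scalerDl.
Qed.

Lemma clmulDr : right_distributive clmul +%R.
Proof.
move=> c a b; rewrite /clmul -big_split; apply: eq_bigr => A _ /=.
rewrite -big_split; apply: eq_bigr => B _ /=.
by rewrite clcoefD mulrDr mulrDl scalerDl.
Qed.

Lemma clmulZl x a b : clmul (x *: a) b = x *: clmul a b.
Proof.
rewrite /clmul scaler_sumr; apply: eq_bigr => A _.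
by rewrite scaler_sumr; apply: eq_bigr => B _; rewrite clcoefZ scalerA !mulrA.
Qed.

Lemma clmulZr x a b : clmul a (x *: b) = x *: clmul a b.
Proof.
rewrite /clmul scaler_sumr; apply: eq_bigr => A _.
rewrite scaler_sumr; apply: eq_bigr => B _.
by rewrite clcoefZ scalerA mulrCA !mulrA.
Qed.

Lemma clmul_suml I (r : seq I) (G : I -> Cl) b :
  clmul (\sum_(i <- r) G i) b = \sum_(i <- r) clmul (G i) b.
Proof.
have h0 : clmul 0 b = 0 by rewrite -(scale0r (0 : Cl)) clmulZl !scale0r.
exact: (big_morph (clmul^~ b) (fun x y => clmulDl x y b) h0).
Qed.

Lemma clmul_sumr I (r : seq I) (G : I -> Cl) b :
  clmul b (\sum_(i <- r) G i) = \sum_(i <- r) clmul b (G i).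
Proof.
have h0 : clmul b 0 = 0 by rewrite -(scale0r (0 : Cl)) clmulZr !scale0r.
exact: (big_morph (clmul b) (clmulDr b) h0).
Qed.

Lemma clmul_blade A B :
  clmul (blade A) (blade B) = (-1) ^+ blade_inv A B *: blade (symdiff A B).
Proof.
rewrite /clmul (bigD1 A) //= [X in _ + X]big1 ?addr0; last first.
  move=> A' nA; rewrite big1 // => B' _.
  by rewrite mkclE (negbTE nA) !mul0r scale0r.
rewrite (bigD1 B) //= [X in _ + X]big1 ?addr0; last first.
  by move=> B' nB; rewrite [in blade B _]mkclE (negbTE nB) mulr0 mul0r scale0r.
by rewrite !mkclE !eqxx !mul1r.
Qed.

Lemma symdiffA : associative (@symdiff m).
Proof. by move=> A B C; apply/setP => i; rewrite !inE addbA. Qed.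

Lemma symdiff0s (A : {set 'I_m}) : symdiff finset.set0 A = A.
Proof. by apply/setP => i; rewrite !inE. Qed.

Lemma symdiffs0 (A : {set 'I_m}) : symdiff A finset.set0 = A.
Proof. by apply/setP => i; rewrite !inE addbF. Qed.

Lemma blade_inv0s (A : {set 'I_m}) : blade_inv finset.set0 A = 0%N.
Proof. by rewrite /blade_inv big_set0. Qed.

Lemma blade_invs0 (A : {set 'I_m}) : blade_inv A finset.set0 = 0%N.
Proof. by rewrite /blade_inv big1 // => a _; rewrite big_set0. Qed.

Lemma odd_blade_inv (A B : {set 'I_m}) : odd (blade_inv A B) =
  \big[addb/false]_a \big[addb/false]_b
     [&& a \in A, b \in B & (b <= a)%N].
Proof.
rewrite /blade_inv (big_morph odd oddD (erefl _)) big_mkcond /=.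
apply: eq_bigr => a _; case: (a \in A) => /=; last by rewrite big1.
rewrite (big_morph odd oddD (erefl _)) big_mkcond /=.
by apply: eq_bigr => b _; case: (b \in B) => //=; rewrite oddb.
Qed.

Lemma odd_blade_invDl (A B C : {set 'I_m}) : odd (blade_inv (symdiff A B) C) =
  odd (blade_inv A C) (+) odd (blade_inv B C).
Proof.
rewrite !odd_blade_inv -big_split; apply: eq_bigr => a _ /=.
rewrite -big_split; apply: eq_bigr => b _ /=; rewrite inE.
by case: (a \in A); case: (a \in B); case: (b \in C); case: (b <= a)%N.
Qed.

Lemma odd_blade_invDr (A B C : {set 'I_m}) : odd (blade_inv A (symdiff B C)) =
  odd (blade_inv A B) (+) odd (blade_inv A C).
Proof.
rewrite !odd_blade_inv -big_split; apply: eq_bigr => a _ /=.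
rewrite -big_split; apply: eq_bigr => b _ /=; rewrite inE.
by case: (a \in A); case: (b \in B); case: (b \in C); case: (b <= a)%N.
Qed.

Lemma clmul_bladesl a b : clmul a b = \sum_A a A *: clmul (blade A) b.
Proof.
rewrite {1}(cl_blades a) clmul_suml; apply: eq_bigr => A _.
exact: clmulZl.
Qed.

Lemma clmul_bladesr a b : clmul a b = \sum_A b A *: clmul a (blade A).
Proof.
rewrite {1}(cl_blades b) clmul_sumr; apply: eq_bigr => A _.
exact: clmulZr.
Qed.

Lemma clmulA_blade A B C : clmul (blade A) (clmul (blade B) (blade C)) =
  clmul (clmul (blade A) (blade B)) (blade C).
Proof.
rewrite !clmul_blade clmulZr clmulZl !clmul_blade !scalerA symdiffA.
congr (_ *: _); rewrite -!exprD -[LHS]signr_odd -[RHS]signr_odd !oddD.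
rewrite odd_blade_invDl odd_blade_invDr.
by do 3![case: (odd _)].
Qed.

Lemma clmulA : associative clmul.
Proof.
move=> a b c.
rewrite clmul_bladesl [in RHS](clmul_bladesl a) clmul_suml.
apply: eq_bigr => A _; rewrite clmulZl; congr (_ *: _).
rewrite (clmul_bladesl b) clmul_sumr [in RHS](clmul_bladesr (blade A)) clmul_suml.
apply: eq_bigr => B _; rewrite clmulZl clmulZr; congr (_ *: _).
rewrite (clmul_bladesr _ c) clmul_sumr [RHS]clmul_bladesr.
by apply: eq_bigr => C _; rewrite clmulZr clmulA_blade.
Qed.

Lemma clmul1l : left_id (blade finset.set0) clmul.
Proof.
move=> a; rewrite [in LHS](cl_blades a) clmul_sumr [RHS]cl_blades.
apply: eq_bigr => A _.
by rewrite clmulZr clmul_blade blade_inv0s expr0 scale1r symdiff0s.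
Qed.

Lemma clmul1r : right_id (blade finset.set0) clmul.
Proof.
move=> a; rewrite [in LHS](cl_blades a) clmul_suml [RHS]cl_blades.
apply: eq_bigr => A _.
by rewrite clmulZl clmul_blade blade_invs0 expr0 scale1r symdiffs0.
Qed.

Lemma blade0_neq0 : blade finset.set0 != 0.
Proof.
apply/eqP => /(congr1 (fun a : Cl => a finset.set0)).
by rewrite mkclE clcoef0 eqxx => /eqP; rewrite oner_eq0.
Qed.

HB.instance Definition _ := GRing.Zmodule_isNzRing.Build Cl
  clmulA clmul1l clmul1r clmulDl clmulDr blade0_neq0.

HB.instance Definition _ := GRing.Lmodule_isLalgebra.Build F Cl
  (fun x a b => esym (clmulZl x a b)).

HB.instance Definition _ := GRing.Lalgebra_isAlgebra.Build F Cl
  (fun x a b => esym (clmulZr x a b)).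

Definition clgen (j : 'I_m) : Cl := blade [set j].

Lemma clgen_sqr j : clgen j ^+ 2 = -1.
Proof.
rewrite expr2 [LHS]clmul_blade /blade_inv !big_set1 leqnn expr1 scaleN1r.
by congr (- blade _); apply/setP => i; rewrite !inE addbb.
Qed.

Lemma clgen_anticomm i j : i != j -> clgen i * clgen j + clgen j * clgen i = 0.
Proof.
move=> nij; rewrite [clgen i * _]clmul_blade [clgen j * _]clmul_blade.
have -> : symdiff [set j] [set i] = symdiff [set i] [set j].
  by apply/setP => k; rewrite !inE addbC.
rewrite -scalerDl /blade_inv !big_set1.
have /orP[lt|lt] : ((i < j) || (j < i))%N by rewrite -neq_ltn.
  by rewrite (ltnW lt) (leqNgt j i) lt expr0 expr1 addrN scale0r.
by rewrite (ltnW lt) (leqNgt i j) lt expr0 expr1 addNr scale0r.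
Qed.

Lemma blade_prod (A : {set 'I_m}) : blade A = \prod_(j <- enum A) clgen j.
Proof.
have {1}-> : A = [set i in enum A] by apply/setP => i; rewrite inE mem_enum.
have : sorted (fun i j : 'I_m => (i < j)%N) (enum A).
  rewrite {1}/enum_mem; apply: sorted_filter.
    by move=> x y z; exact: ltn_trans.
  have -> : (fun i j : 'I_m => (i < j)%N) = relpre val ltn by [].
  by rewrite -enumT -sorted_map val_enum_ord iota_ltn_sorted.
elim: (enum A) => [|i s IH] /=.
  rewrite big_nil -[RHS]/(blade finset.set0).
  by move=> _; congr (blade _); apply/setP => i; rewrite !inE.
move=> ps; have := order_path_min (fun y x z : 'I_m => @ltn_trans y x z) ps.
move/allP => lts; rewrite big_cons -IH ?(path_sorted ps) //.
have -> : clgen i * blade [set j in s] = clmul (clgen i) (blade [set j in s]) by [].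
rewrite [RHS]clmul_blade /blade_inv big_set1 big1 ?expr0 ?scale1r; last first.
  by move=> j; rewrite inE => /lts ij; rewrite (leqNgt j i) ij.
congr (blade _); apply/setP => j; rewrite !inE.
case: eqVneq => [->|] //=; case E : (i \in s) => //.
by move: (lts _ E); rewrite ltnn.
Qed.

End CliffordRing.

Arguments blade {F m} A.
Arguments clgen {F m} j.

(* R^n is 'rV[R]_n with the product sigma-algebra; its Lebesgue measure is the *)
(* n-fold product of the one-dimensional one.                                  *)

Section MeasurableRow.
Local Open Scope classical_set_scope.
Context {d} {T : sigmaRingType d}.
Variable n : nat.

Let coord : 'I_n -> 'rV[T]_n -> T := fun i x => x ord0 i.

Let row_set0 : g_sigma_preimage coord set0.
Proof. exact: sigma_algebra0. Qed.

Let row_setC A : g_sigma_preimage coord A -> g_sigma_preimage coord (~` A).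
Proof. exact: sigma_algebraC. Qed.

Let row_bigcup (F : _^nat) : (forall i, g_sigma_preimage coord (F i)) ->
  g_sigma_preimage coord (\bigcup_i (F i)).
Proof. exact: sigma_algebra_bigcup. Qed.

HB.instance Definition _ := @isMeasurable.Build (measure_tuple_display d)
  'rV[T]_n (g_sigma_preimage coord) row_set0 row_setC row_bigcup.

Lemma measurable_row_coord (i : 'I_n) :
  measurable_fun [set: 'rV[T]_n] (fun x : 'rV[T]_n => x ord0 i).
Proof.
move=> _ Y mY; rewrite setTI; apply: sub_sigma_algebra => /=.
rewrite -bigcup_seq/=; exists i => /=; first by rewrite mem_index_enum.
by exists Y => //; rewrite setTI.
Qed.

End MeasurableRow.

Section MeasurableRowTheory.
Local Open Scope classical_set_scope.

Lemma measurable_to_row d d' (T : measurableType d) (T' : measurableType d')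
    (n : nat) (f : T' -> 'rV[T]_n) :
  (forall i, measurable_fun [set: T'] (fun x => f x ord0 i)) ->
  measurable_fun [set: T'] f.
Proof.
move=> mf; apply: (@measurability _ _ _ _ _ _
  (\big[setU/set0]_(i < n) preimage_set_system setT
     (fun x : 'rV[T]_n => x ord0 i) measurable)) => //.
move=> _ [A + <-].
rewrite -bigcup_seq/= => -[i _ [B mB <-]].
by rewrite !setTI -[X in measurable X]setTI; exact: (mf i).
Qed.

Lemma product_sigma_finite d1 d2 (T1 : measurableType d1)
    (T2 : measurableType d2) (R : realType)
    (m1 : {sigma_finite_measure set T1 -> \bar R})
    (m2 : {sigma_finite_measure set T2 -> \bar R}) :
  sigma_finite setT (m1 \x m2)%E.
Proof.
have /sigma_finiteP[F [TF ndF Foo]] := sigma_finiteT m1.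
have /sigma_finiteP[G [TG ndG Goo]] := sigma_finiteT m2.
exists (fun n => F n `*` G n).
  rewrite -setXTT TF TG predeqE => -[x y]; split.
    move=> [/= [n _ Fnx] [k _ Gky]]; exists (maxn n k) => //; split.
    - by move: x Fnx; exact/subsetPset/ndF/leq_maxl.
    - by move: y Gky; exact/subsetPset/ndG/leq_maxr.
  by move=> [n _ []/= ? ?]; split; exists n.
move=> k; have [? ?] := Foo k; have [? ?] := Goo k.
split; first exact: measurableX.
by rewrite product_measure1E// lte_mul_pinfty// ge0_fin_numE.
Qed.

Lemma pushforward_semi_sigma_additive d1 d2 (T1 : measurableType d1)
    (T2 : measurableType d2) (R : realType) (m : {measure set T1 -> \bar R})
    (f : T1 -> T2) :
  measurable_fun [set: T1] f -> semi_sigma_additive (pushforward m f).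
Proof.
move=> mf F mF tF mUF; rewrite /pushforward preimage_bigcup.
apply: measure_semi_sigma_additive.
- by move=> i; rewrite -[X in measurable X]setTI; exact: mf.
- apply/trivIsetP => /= i j _ _ ij; rewrite -preimage_setI.
  by move/trivIsetP : tF => /(_ _ _ _ _ ij) ->//; rewrite preimage_set0.
- by rewrite -preimage_bigcup -[X in measurable X]setTI; exact: mf.
Qed.

End MeasurableRowTheory.

Section Lebesgue.
Local Open Scope classical_set_scope.
Variable R : realType.

Section step.
Variables (n : nat) (mu : {sigma_finite_measure set 'rV[R]_n -> \bar R}).

Definition row_cons (p : measurableTypeR R * 'rV[R]_n) : 'rV[R]_n.+1 :=
  \row_i (if unlift ord0 i is Some j then p.2 ord0 j else p.1).

Definition row_uncons (x : 'rV[R]_n.+1) : measurableTypeR R * 'rV[R]_n :=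
  (x ord0 ord0, \row_j x ord0 (lift ord0 j)).

Lemma row_consK : cancel row_cons row_uncons.
Proof.
move=> [t v]; rewrite /row_uncons /row_cons !mxE unlift_none /=.
by congr pair; apply/rowP => j; rewrite !mxE liftK.
Qed.

Lemma measurable_row_cons : measurable_fun [set: measurableTypeR R * 'rV[R]_n] row_cons.
Proof.
apply: measurable_to_row => i.
rewrite (_ : (fun _ => _) = (fun p : measurableTypeR R * 'rV[R]_n =>
  if unlift ord0 i is Some j then p.2 ord0 j else p.1)); last first.
  by apply/funext => p; rewrite mxE.
case: (unlift ord0 i) => [j|]; last exact: measurable_fst.
exact: (measurableT_comp (measurable_row_coord j) measurable_snd).
Qed.

Lemma measurable_row_uncons : measurable_fun [set: 'rV[R]_n.+1] row_uncons.
Proof.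
apply: measurable_fun_pair; first exact: measurable_row_coord.
apply: measurable_to_row => i.
rewrite (_ : (fun _ => _) = fun x : 'rV[R]_n.+1 => x ord0 (lift ord0 i)).
  exact: measurable_row_coord.
by apply/funext => x; rewrite mxE.
Qed.

Definition lebesgue_cons : set 'rV[R]_n.+1 -> \bar R :=
  pushforward ((@lebesgue_measure R) \x mu)%E row_cons.

Let lebesgue_cons0 : lebesgue_cons set0 = 0%E.
Proof. by rewrite /lebesgue_cons /pushforward preimage_set0 measure0. Qed.

Let lebesgue_cons_ge0 A : (0 <= lebesgue_cons A)%E.
Proof. by rewrite /lebesgue_cons /pushforward; exact: measure_ge0. Qed.

Let lebesgue_cons_sigma_additive : semi_sigma_additive lebesgue_cons.
Proof. exact: (pushforward_semi_sigma_additive measurable_row_cons). Qed.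

HB.instance Definition _ := isMeasure.Build _ _ _ lebesgue_cons
  lebesgue_cons0 lebesgue_cons_ge0 lebesgue_cons_sigma_additive.

Let lebesgue_cons_sigma_finite : sigma_finite setT lebesgue_cons.
Proof.
have [F FT Foo] := product_sigma_finite (@lebesgue_measure R) mu.
exists (fun k => row_uncons @^-1` F k).
  by rewrite -preimage_bigcup -FT preimage_setT.
move=> k; have [mF Fk] := Foo k; split.
  by rewrite -[X in measurable X]setTI; exact: measurable_row_uncons.
rewrite /lebesgue_cons /pushforward -comp_preimage.
suff -> : row_uncons \o row_cons = id by [].
by apply/funext => p /=; rewrite row_consK.
Qed.

HB.instance Definition _ := Measure_isSigmaFinite.Build _ _ _ lebesgue_cons
  lebesgue_cons_sigma_finite.

End step.

Fixpoint lebesgue_row (n : nat) : {sigma_finite_measure set 'rV[R]_n -> \bar R} :=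
  match n with
  | 0 => dirac (0 : 'rV[R]_0)
  | n'.+1 => lebesgue_cons (lebesgue_row n')
  end.

End Lebesgue.

(* The surface measure of the unit sphere is obtained from the cone formula:   *)
(* sigma(A) = m * volume {x | 0 < |x| <= 1 and x / |x| \in A}.                 *)

Section Sphere.
Local Open Scope classical_set_scope.
Variables (R : realType) (m : nat).
Implicit Types x : 'rV[R]_m.

Definition enorm x : R := Num.sqrt (\sum_j x ord0 j ^+ 2).

Definition normalize x : 'rV[R]_m := (enorm x)^-1 *: x.

Definition punctured_ball : set 'rV[R]_m := [set x | 0 < enorm x <= 1].

Definition unit_sphere : set 'rV[R]_m := [set x | enorm x = 1].

Lemma measurable_enorm : measurable_fun [set: 'rV[R]_m] enorm.
Proof.
have -> : enorm = (fun x => (\sum_j x ord0 j ^+ 2) `^ 2^-1).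
  apply/funext => x; rewrite powR12_sqrt //.
  by apply: sumr_ge0 => j _; exact: sqr_ge0.
apply: (measurableT_comp (measurable_powR _)) => /=.
apply: measurable_sum => j; apply: measurable_funX.
exact: measurable_row_coord.
Qed.

Lemma measurable_normalize : measurable_fun [set: 'rV[R]_m] normalize.
Proof.
apply: measurable_to_row => i.
rewrite (_ : (fun _ => _) = fun x => enorm x `^ (-1) * x ord0 i).
  apply: measurable_funM; last exact: measurable_row_coord.
  exact: (measurableT_comp (measurable_powR _) measurable_enorm).
by apply/funext => x; rewrite mxE powR_inv1 // sqrtr_ge0.
Qed.

Lemma measurable_punctured_ball : measurable punctured_ball.
Proof.
have -> : punctured_ball = enorm @^-1` `]0, 1]%classic.
  by apply/seteqP; split=> x /=; rewrite in_itv.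
by rewrite -[X in measurable X]setTI; exact: measurable_enorm.
Qed.

Definition cone_measure : set 'rV[R]_m -> \bar R :=
  pushforward (mrestr (lebesgue_row R m) measurable_punctured_ball) normalize.

Let cone_measure0 : cone_measure set0 = 0%E.
Proof. by rewrite /cone_measure /pushforward preimage_set0 measure0. Qed.

Let cone_measure_ge0 A : (0 <= cone_measure A)%E.
Proof. by rewrite /cone_measure /pushforward; exact: measure_ge0. Qed.

Let cone_measure_sigma_additive : semi_sigma_additive cone_measure.
Proof. exact: (pushforward_semi_sigma_additive measurable_normalize). Qed.

HB.instance Definition _ := isMeasure.Build _ _ _ cone_measure
  cone_measure0 cone_measure_ge0 cone_measure_sigma_additive.

Definition sphere_measure : set 'rV[R]_m -> \bar R :=
  mscale m%:R%:nng cone_measure.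

HB.instance Definition _ := Measure.on sphere_measure.

End Sphere.

(* C^m carries the topology of the modulus on R[i]. *)
HB.instance Definition _ (R : realType) :=
  NormedModule.copy R[i] (R[i]^o).

Section CliffordAnalysis.
Variables (R : realType) (m : nat).
Local Notation Cl := (clifford R m).
Local Notation ClC := (clifford R[i] m).

Definition clvec (F : comNzRingType) (x : 'rV[F]_m) : clifford F m :=
  \sum_j x ord0 j *: clgen j.

Definition clconj (a : Cl) : Cl :=
  mkcl (fun A => (-1) ^+ ((#|A| * #|A|.+1)./2) * a A).

Definition cl_complex (a : Cl) : ClC := mkcl (fun A => (a A)%:C%C).

Definition clnorm (a : ClC) : R := Num.sqrt (\sum_A Normc.normc (a A) ^+ 2).

Definition clint (mu : {measure set 'rV[R]_m -> \bar R})
    (D : set 'rV[R]_m) (g : 'rV[R]_m -> Cl) : Cl :=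
  mkcl (fun A => \int[mu]_(x in D) g x A).

Definition L2 (f : 'rV[R]_m -> Cl) : Prop :=
  forall A, (fun x => f x A) \in Lfun (lebesgue_row R m) 2%:E.

Definition L2_inner (f g : 'rV[R]_m -> Cl) : Cl :=
  clint (lebesgue_row R m) setT (fun x => clconj (f x) * g x).

Definition Gamma (s : R) : R :=
  \int[lebesgue_measure]_(t in `]0%R, +oo[%classic) (t `^ (s - 1) * expR (- t)).

Definition sphere_area : R := 2 * pi `^ (m%:R / 2) / Gamma (m%:R / 2).

Definition sphere_inner (f g : 'rV[R]_m -> Cl) : Cl :=
  sphere_area^-1 *:
    clint (@sphere_measure R m) (@unit_sphere R m) (fun x => clconj (f x) * g x).

Definition partial (j : 'I_m) (g : 'rV[R]_m -> Cl) (x : 'rV[R]_m) : Cl :=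
  mkcl (fun A => 'D_(delta_mx ord0 j) (fun y : 'rV[R]_m => g y A) x).

Definition dirac_op (g : 'rV[R]_m -> Cl) (x : 'rV[R]_m) : Cl :=
  \sum_j clgen j * partial j g x.

(* Polynomials with coefficients in the real Clifford algebra, evaluated at  *)
(* real and at complex points; the variables commute with the coefficients.  *)
Local Notation clpoly := (mpoly.mpoly m Cl).

Definition peval (p : clpoly) (x : 'rV[R]_m) : Cl :=
  mpoly.mmap id (fun j => x ord0 j *: 1) p.

Definition pevalC (p : clpoly) (z : 'rV[R[i]]_m) : ClC :=
  mpoly.mmap cl_complex (fun j => z ord0 j *: 1) p.

Definition inner_monogenic (k : nat) (p : clpoly) : Prop :=
  p \is mpoly.ishomog1 k (@mpoly.mdeg m) /\ forall x, dirac_op (peval p) x = 0.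

Definition dim_monogenic (k : nat) : nat :=
  if k == 0%N then 1%N else 'C(m + k - 2, k).

(* Orthonormal generators of the right module; linear independence over the *)
(* Clifford algebra follows from orthonormality.                            *)
Definition orthonormal_basis (k : nat) (P : 'I_(dim_monogenic k) -> clpoly)
  : Prop :=
  [/\ forall j, inner_monogenic k (P j),
      forall i j, sphere_inner (peval (P i)) (peval (P j)) = (i == j)%:R
    & forall p, inner_monogenic k p ->
        exists c : 'I_(dim_monogenic k) -> Cl,
          p = \sum_j P j * mpoly.mpolyC m (c j)].

(* The function H_(l,m,k) P, for P an inner monogenic of order k: the        *)
(* Clifford-Hermite polynomials enter only through these products.           *)
Definition hermite (l : nat) (p : clpoly) (x : 'rV[R]_m) : Cl :=
  (expR (enorm x ^+ 2 / 2) * (-1) ^+ l) *: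
    iter l dirac_op (fun y => expR (- (enorm y ^+ 2 / 2)) *: peval p y) x.

(* l = 2 p or l = 2 p + 1 *)
Definition gamma_lk (l k : nat) : R :=
  let p := l./2 in
  if odd l then
    2 `^ ((2 * p)%:R + m%:R / 2 + k%:R + 1) * p`!%:R * Num.sqrt pi ^+ m
      * Gamma (m%:R / 2 + k%:R + p%:R + 1) / Gamma (m%:R / 2)
  else
    2 `^ ((2 * p)%:R + m%:R / 2 + k%:R) * p`!%:R * Num.sqrt pi ^+ m
      * Gamma (m%:R / 2 + k%:R + p%:R) / Gamma (m%:R / 2).

Definition phi (l k : nat) (p : clpoly) (x : 'rV[R]_m) : Cl :=
  ((Num.sqrt (gamma_lk l k))^-1 * expR (- (enorm x ^+ 2 / 4))) *: hermite l p x.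

Definition Psi (l k : nat) (p : clpoly) (z : 'rV[R[i]]_m) : ClC :=
  ((Num.sqrt (gamma_lk l k))^-1)%:C%C *: (clvec z ^+ l * pevalC p z).

Definition has_sum (u : nat -> ClC) (s : ClC) : Prop :=
  (clnorm (\sum_(i < n) u i - s) @[n --> \oo] --> 0)%classic.

Definition has_iterated_sum (u : nat -> nat -> ClC) (s : ClC) : Prop :=
  exists t : nat -> ClC, (forall l, has_sum (u l) (t l)) /\ has_sum t s.

End CliffordAnalysis.

(* Main.v *)
(* Only crude bounds are needed, not the orthonormality of the functions phi.
   Writing D for the Dirac operator, D (e^(-|x|^2/2) q) = e^(-|x|^2/2) T q for
   polynomials q, where T raises or lowers degrees by one.  For the weighted
   l^1 norm of coefficients with weight w_n = sqrt(n!) 2^n in degree n, T has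
   norm O(sqrt(degree)), and |x|^n <= w_n e^(|x|^2/8); hence
   |H_(l,m,k) P_k| e^(-|x|^2/4) <= c^(l+k) sqrt((l+k)!) |P_k|_1 e^(-|x|^2/8),
   and the same bound, up to a constant, holds for the unnormalised inner
   product with f.  The coefficients of an orthonormal P_k are at most c^k:
   finite differences express them by the values of P_k on a lattice of mesh
   ~ 1/k, averaging over translates of the lattice bounds them by the integral
   of |P_k| over the unit ball, and homogeneity compares that with the sphere.
   Finally gamma_(l,k) >= c^(-l-k) p! (l-p+k)! with p = floor(l/2), while
   (l+k)! <= 2^(l+k) p! (l-p+k)!, so the (l,k) term is at most
   c^(l+k) / sqrt(p! k!), uniformly on compact sets, which is summable. *)

Require Import Defs.
From HB Require Import structures.
From mathcomp Require Import all_boot all_order all_algebra.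
From mathcomp Require mpoly.
Import -(notations) mpoly.
From mathcomp Require Import all_classical all_reals all_analysis.
From mathcomp Require Import measurable_realfun complex ring lra.

Set Implicit Arguments.
Unset Strict Implicit.
Unset Printing Implicit Defensive.

Import Order.TTheory GRing.Theory Num.Theory.
Import numFieldNormedType.Exports.

Local Open Scope classical_set_scope.
Local Open Scope ring_scope.

(** * Lebesgue measure on rows *)

Section LebesgueRow.
Variable R : realType.
Local Notation mu := (@lebesgue_measure R).
Local Notation lam := (@lebesgue_row R).

(** Translation is named and declared a measurable function so that its pushforward of [mu] can be
    used as a measure. *)
Let addr_ (a : R) (x : measurableTypeR R) : measurableTypeR R := x + a.

Lemma measurable_addr (a : R) : measurable_fun [set: measurableTypeR R] (addr_ a).
Proof. exact: measurable_funD. Qed.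

HB.instance Definition _ (a : R) :=
  isMeasurableFun.Build _ _ _ _ (addr_ a) (measurable_addr a).

(** Lebesgue measure is determined by its values on half-open intervals, and translation preserves
    their length. *)
Lemma lebesgue_measure_translation (a : R) (A : set (measurableTypeR R)) :
  measurable A -> mu A = pushforward mu (addr_ a) A.
Proof.
move=> mA; apply: (@lebesgue_measure_unique _ (pushforward mu (addr_ a))) => // X.
move=> [[b c] _ <-] /=.
have -> : pushforward mu (addr_ a) `]b, c] = mu `]b - a, c - a]%classic.
  congr (mu _); apply/seteqP; split=> x /=; rewrite !in_itv /= /addr_;
    by rewrite ltrBlDr lerBrDr.
rewrite !lebesgue_measure_itv /= !lte_fin ltrD2r; case: ifP => // _.
by rewrite -!EFinD; congr (_%:E); ring.
Qed.

Lemma ge0_integral_translation (a : R) (f : measurableTypeR R -> \bar R) :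
  measurable_fun setT f -> (forall x, (0 <= f x)%E) ->
  (\int[mu]_x f (x + a)%R = \int[mu]_x f x)%E.
Proof.
move=> mf f0.
have := @ge0_integral_pushforward _ _ _ _ _ _ (measurable_addr a) mu _ f
  measurableT mf (fun x _ => f0 x).
rewrite preimage_setT => <-.
by apply: eq_measure_integral => A mA _; exact/esym/lebesgue_measure_translation.
Qed.

(** [lebesgue_row] is by recursion the pushforward of a product measure, so this is a change of
    variables followed by Tonelli. It drives the inductions on the dimension below. *)
Lemma ge0_integral_row_cons n (f : 'rV[R]_n.+1 -> \bar R) :
  measurable_fun setT f -> (forall x, (0 <= f x)%E) ->
  (\int[lam n.+1]_x f x = \int[mu]_t \int[lam n]_v f (row_cons (t, v)))%E.
Proof.
move=> mf f0.
have -> : (\int[lam n.+1]_x f x = \int[mu \x lam n]_p f (row_cons p))%E.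
  by rewrite [LHS](@ge0_integral_pushforward _ _ _ _ _ _ (@measurable_row_cons R n)
    _ _ f measurableT mf).
rewrite (@fubini_tonelli1 _ _ _ _ _ mu (lam n) (f \o (@row_cons R n))) //.
- exact: (measurableT_comp mf (@measurable_row_cons R n)).
- by move=> p; exact: f0.
Qed.

Lemma measurable_row_add n (v : 'rV[R]_n) :
  measurable_fun [set: 'rV[R]_n] (fun x => x + v).
Proof.
apply: measurable_to_row => i; under eq_fun do rewrite mxE.
by apply: measurable_funD => //; exact: measurable_row_coord.
Qed.

(** Tonelli splits off the first coordinate: the outer integral is translated in dimension one, the
    inner one by induction. *)
Lemma ge0_integral_row_translation n (w : 'rV[R]_n) (f : 'rV[R]_n -> \bar R) :
  measurable_fun setT f -> (forall x, (0 <= f x)%E) ->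
  (\int[lam n]_x f (x + w)%R = \int[lam n]_x f x)%E.
Proof.
elim: n w f => [|n IH] w f mf f0.
  by apply: eq_integral => x _; congr f; apply/rowP; case.
have mfw : measurable_fun setT (fun x : 'rV[R]_n.+1 => f (x + w)).
  exact: (measurableT_comp mf (measurable_row_add w)).
rewrite !ge0_integral_row_cons //.
have mfc : measurable_fun setT (fun p : measurableTypeR R * 'rV[R]_n => f (row_cons p)).
  exact: (measurableT_comp mf (@measurable_row_cons R n)).
rewrite -(@ge0_integral_translation (w ord0 ord0)
  (fun t => (\int[lam n]_v f (row_cons (t, v)))%E)); last 2 first.
- apply: (measurable_fun_fubini_tonelli_F (m2 := lam n) (f \o @row_cons R n)).
    exact: mfc.
  by move=> p; exact: f0.
- by move=> t; exact: integral_ge0.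
apply: eq_integral => t _.
rewrite -(IH (\row_j w ord0 (lift ord0 j)) (fun v => f (row_cons (t + w ord0 ord0, v)))) //.
  apply: eq_integral => v _; congr f; apply/rowP => i; rewrite !mxE.
  by case: unliftP => [j|] -> /=; rewrite ?mxE.
exact: (measurableT_comp mfc (pair1_measurable _)).
Qed.

(** The coordinates are strictly positive so that the cube and its translates by lattice points
    avoid the origin, which [punctured_ball] excludes. *)
Lemma measurable_row_cube n (d : R) :
  measurable [set x : 'rV[R]_n | forall j, 0 < x ord0 j <= d].
Proof.
have -> : [set x : 'rV[R]_n | forall j, 0 < x ord0 j <= d] =
  \bigcap_(j in [set: 'I_n]) ((fun x : 'rV[R]_n => x ord0 j) @^-1` `]0, d]).
  by apply/seteqP; split=> x /= h j;
    [move=> _ /=; rewrite in_itv; exact: h|have := h j I; rewrite /= in_itv].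
apply: fin_bigcap_measurable => // j _.
by rewrite -[X in measurable X]setTI; exact: measurable_row_coord.
Qed.

Lemma lebesgue_row_cube n (d : R) : 0 < d ->
  lam n [set x | forall j, 0 < x ord0 j <= d] = (d ^+ n)%:E.
Proof.
move=> d0; elim: n => [|n IH].
  rewrite /= diracE mem_set ?expr0 //= => -[]//.
have mI : measurable (`]0%R, d] : set (measurableTypeR R)) by exact: measurable_itv.
have mC := @measurable_row_cube n d.
have -> : lam n.+1 [set x | forall j, 0 < x ord0 j <= d] =
   (mu \x lam n)%E (`]0%R, d]%classic `*` [set x : 'rV[R]_n | forall j, 0 < x ord0 j <= d]).
  rewrite /= /lebesgue_cons /pushforward; congr ((_ \x _)%E _).
  apply/seteqP; split=> -[t v] /=.
    move=> h; split=> [|j].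
      by have := h ord0; rewrite mxE unlift_none in_itv.
    by have := h (lift ord0 j); rewrite mxE liftK.
  rewrite in_itv /= => -[ht hv] i; rewrite mxE.
  by case: unliftP => [j|] _ /=.
rewrite product_measure1E // IH.
by rewrite [X in (X * _)%E](lebesgue_measure_itv `]0, d]) /= lte_fin d0 oppr0 adde0 -EFinM exprS.
Qed.

(** The integrand is a constant multiple of the centred normal density of variance 2. *)
Lemma integral_gauss4_fin : (\int[mu]_x (expR (- (x ^+ 2 / 4)))%:E < +oo)%E.
Proof.
pose s : R := Num.sqrt 2.
have s0 : s != 0 by rewrite sqrtr_eq0 -ltNge.
have -> : (\int[mu]_x (expR (- (x ^+ 2 / 4)))%:E =
  \int[mu]_x ((normal_peak s)^-1%:E * (normal_pdf 0 s x)%:E))%E.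
  apply: eq_integral => x _; rewrite normal_pdfE // -EFinM mulKf ?gt_eqF ?normal_peak_gt0 //.
  congr (expR _)%:E; rewrite subr0 sqr_sqrtr // mulNr.
  by have -> : (2 : R) *+ 2 = 4 by ring.
rewrite ge0_integralZl //; last 3 first.
- by apply/measurable_EFinP; exact: measurable_normal_pdf.
- by move=> x _; rewrite lee_fin normal_pdf_ge0.
- by rewrite lee_fin invr_ge0 normal_peak_ge0.
by rewrite integral_normal_pdf mule1 ltry.
Qed.

Lemma measurable_row_gauss4 n :
  measurable_fun setT (fun x : 'rV[R]_n => expR (- (enorm x ^+ 2 / 4))).
Proof.
apply: measurableT_comp => //; apply: measurableT_comp => //.
apply: measurable_funM => //; apply: measurable_funX; exact: measurable_enorm.
Qed.

Lemma enorm2 n (x : 'rV[R]_n) : enorm x ^+ 2 = \sum_j x ord0 j ^+ 2.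
Proof. by rewrite sqr_sqrtr // sumr_ge0 // => j _; exact: sqr_ge0. Qed.

Lemma integral_row_gauss4_fin n :
  (\int[lam n]_x (expR (- (enorm x ^+ 2 / 4)))%:E < +oo)%E.
Proof.
elim: n => [|n IH].
  rewrite integral_dirac //; last by apply/measurable_EFinP; exact: measurable_row_gauss4.
  by rewrite diracT mul1e ltry.
rewrite ge0_integral_row_cons; last 2 first.
- by apply/measurable_EFinP; exact: measurable_row_gauss4.
- by move=> x; rewrite lee_fin expR_ge0.
have -> : (\int[mu]_t \int[lam n]_v (expR (- (enorm (row_cons (t, v)) ^+ 2 / 4)))%:E =
  \int[mu]_t (\int[lam n]_v (expR (- (enorm v ^+ 2 / 4)))%:E * (expR (- (t ^+ 2 / 4)))%:E))%E.
  apply: eq_integral => t _; rewrite muleC -ge0_integralZl //; last first.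
    by apply/measurable_EFinP; exact: measurable_row_gauss4.
  apply: eq_integral => v _; rewrite -EFinM -expRD !enorm2 big_ord_recl mxE unlift_none /=.
  congr (expR _)%:E; rewrite mulrDl opprD; congr (_ - _ / _).
  by apply: eq_bigr => j _; rewrite mxE liftK.
have mg : measurable_fun setT (fun t : measurableTypeR R => expR (- (t ^+ 2 / 4))).
  apply: measurableT_comp => //; apply: measurableT_comp => //.
  by apply: measurable_funM => //; apply: measurable_funX.
rewrite ge0_integralZl //; last 2 first.
- exact/measurable_EFinP.
- by apply: integral_ge0 => x _; rewrite lee_fin expR_ge0.
rewrite lte_mul_pinfty ?integral_gauss4_fin //.
  by apply: integral_ge0 => x _; rewrite lee_fin expR_ge0.
rewrite ge0_fin_numE //.
by apply: integral_ge0 => x _; rewrite lee_fin expR_ge0.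
Qed.

End LebesgueRow.

(** * The l^1 norm of Clifford numbers *)

Section CliffordNorm.
Variables (F : numDomainType) (m : nat).
Local Notation Cl := (clifford F m).
Implicit Types a b : Cl.

(** Preferred to the Euclidean norm because it is submultiplicative with constant 1. Over [R[i]] its
    values are complex numbers, hence the casts of real bounds into [R[i]] below. *)
Definition cl1 a : F := \sum_A `|a A|.

Lemma cl1_ge0 a : 0 <= cl1 a.
Proof. exact: sumr_ge0. Qed.

Lemma cl1_coef a A : `|a A| <= cl1 a.
Proof. by rewrite /cl1 (bigD1 A) //= lerDl sumr_ge0. Qed.

Lemma cl10 : cl1 0 = 0.
Proof. by rewrite /cl1 big1 // => A _; rewrite clcoef0 normr0. Qed.

Lemma cl1D a b : cl1 (a + b) <= cl1 a + cl1 b.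
Proof. by rewrite -big_split; apply: ler_sum => A _; rewrite clcoefD ler_normD. Qed.

Lemma cl1_sum I (r : seq I) (P : pred I) (G : I -> Cl) :
  cl1 (\sum_(i <- r | P i) G i) <= \sum_(i <- r | P i) cl1 (G i).
Proof.
elim/big_ind2: _ => //; first by rewrite cl10.
by move=> x1 x2 y1 y2 h1 h2; rewrite (le_trans (cl1D _ _)) // lerD.
Qed.

Lemma cl1Z x a : cl1 (x *: a) = `|x| * cl1 a.
Proof. by rewrite mulr_sumr; apply: eq_bigr => A _; rewrite clcoefZ normrM. Qed.

Lemma cl1_blade A : cl1 (blade A) = 1.
Proof.
rewrite /cl1 (bigD1 A) //= mkclE eqxx normr1 big1 ?addr0 // => B nB.
by rewrite mkclE (negbTE nB) normr0.
Qed.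

Lemma cl11 : cl1 1 = 1.
Proof. exact: cl1_blade. Qed.

(** The product of two blades is a blade up to sign, hence of norm 1. *)
Lemma cl1M a b : cl1 (a * b) <= cl1 a * cl1 b.
Proof.
rewrite (le_trans (cl1_sum _ _ _)) // mulr_suml; apply: ler_sum => A _.
rewrite (le_trans (cl1_sum _ _ _)) // mulr_sumr; apply: ler_sum => B _.
by rewrite cl1Z cl1_blade mulr1 !normrM normrX normrN1 expr1n mulr1.
Qed.

Lemma cl1X a n : cl1 (a ^+ n) <= cl1 a ^+ n.
Proof.
elim: n => [|n IH]; first by rewrite !expr0 cl11.
by rewrite !exprS (le_trans (cl1M _ _)) // ler_wpM2l ?cl1_ge0.
Qed.

Lemma cl1_gen j : cl1 (clgen j) = 1.
Proof. exact: cl1_blade. Qed.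

Lemma cl1_clvec (x : 'rV[F]_m) : cl1 (clvec x) <= \sum_j `|x ord0 j|.
Proof.
rewrite (le_trans (cl1_sum _ _ _)) //; apply: ler_sum => j _.
by rewrite cl1Z cl1_gen mulr1.
Qed.

End CliffordNorm.

(** * Conjugation, and geometrically dominated series of Clifford numbers *)

Section CliffordReal.
Variables (R : realType) (m : nat).
Local Notation Cl := (clifford R m).
Local Notation ClC := (clifford R[i] m).

Lemma cl1_conj (a : Cl) : cl1 (clconj a) = cl1 a.
Proof.
by apply: eq_bigr => A _; rewrite mkclE normrM normrX normrN1 expr1n mul1r.
Qed.

Lemma cl1_complex (a : Cl) : cl1 (cl_complex a) = (cl1 a)%:C%C.
Proof.
rewrite /cl1 rmorph_sum; apply: eq_bigr => A _.
by rewrite mkclE normc_def /= expr0n addr0 sqrtr_sqr.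
Qed.

(** The l^2 norm is at most the l^1 norm; this transfers the bounds to the norm of the theorem. *)
Lemma clnorm_le (a : ClC) (M : R) : cl1 a <= M%:C%C -> clnorm a <= M.
Proof.
have -> : cl1 a = (\sum_A Normc.normc (a A))%:C%C.
  by rewrite rmorph_sum; apply: eq_bigr => A _; case: (a A).
rewrite lecR; apply: le_trans.
have n0 A : 0 <= Normc.normc (a A) by case: (a A) => x y; exact: sqrtr_ge0.
have s0 : 0 <= \sum_A Normc.normc (a A) by exact: sumr_ge0.
rewrite -[leRHS](ger0_norm s0) -sqrtr_sqr ler_sqrt ?sqr_ge0 //.
rewrite expr2 mulr_suml; apply: ler_sum => A _.
by rewrite expr2 ler_wpM2l // (bigD1 A) //= lerDl sumr_ge0.
Qed.

(** Counted twice, once with the roles of a and b exchanged, each off-diagonal pair of A x A appears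
    once and each diagonal pair twice. Hence the sign of e_A e_A is the sign in [clconj]. *)
Lemma blade_inv_diag (A : {set 'I_m}) : blade_inv A A = ((#|A| * #|A|.+1)./2)%N.
Proof.
suff : ((blade_inv A A).*2 = #|A| * #|A|.+1)%N by move=> <-; rewrite doubleK.
rewrite -addnn /blade_inv [X in (_ + X)%N]exchange_big /= -big_split /= mulnSr.
have -> : (#|A| * #|A| + #|A| = \sum_(a in A) (#|A| + 1))%N.
  by rewrite big_split /= sum_nat_const sum1_card.
apply: eq_bigr => a aA.
have -> : #|A| = (1 + \sum_(i in A | i != a) 1)%N by rewrite -sum1_card (bigD1 a aA).
rewrite -big_split (bigD1 a aA) /= leqnn [RHS]addnAC; congr (_ + _)%N.
apply: eq_bigr => b /andP[_ ba].
by case: ltngtP ba => // /val_inj ->; rewrite eqxx.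
Qed.

(** Only products e_A e_B with A = B reach the scalar part, and their sign cancels that of the
    conjugation. *)
Lemma clconj_mul0 (a : Cl) : (clconj a * a) finset.set0 = \sum_A a A ^+ 2.
Proof.
rewrite [_ * _]/(clmul _ _) clcoef_sum; apply: eq_bigr => A _.
rewrite clcoef_sum (bigD1 A) //= clcoefZ !mkclE.
have -> : symdiff A A = finset.set0 by apply/setP => i; rewrite !inE addbb.
rewrite eqxx mulr1 blade_inv_diag; set e := (-1) ^+ _.
have -> : e * a A * a A * e = e ^+ 2 * a A ^+ 2 by ring.
rewrite sqrr_sign mul1r.
rewrite big1 ?addr0 // => B nB; rewrite clcoefZ mkclE.
case: eqP => [/setP E|]; last by rewrite mulr0.
case/eqP: nB; apply/setP => i; have := E i; rewrite !inE.
by case: (i \in A); case: (i \in B).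
Qed.

Lemma real_series_geometric (u : nat -> R) (M : R) :
  (forall n, `|u n| <= M / 2 ^+ n) ->
  exists s, \sum_(i < n) u i @[n --> \oo] --> s /\ `|s| <= 2 * M.
Proof.
move=> hu.
have hg : series (geometric M (2^-1)) @ \oo --> M * (1 - 2^-1)^-1.
  by apply: cvg_geometric_series; rewrite ger0_norm // invf_lt1 // ltr1n.
have ug n : `|u n| <= geometric M (2^-1) n by rewrite /= exprVn.
have cn : cvgn [normed series u].
  apply: (series_le_cvg _ _ ug) => //.
  - by move=> n; rewrite (le_trans _ (ug n)).
  - by apply/cvg_ex; exists (M * (1 - 2^-1)^-1).
have cu : cvgn (series u) by exact: normed_cvg.
exists (limn (series u)); split.
  by have := cu; rewrite /series /=; under eq_fun do rewrite big_mkord.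
have -> : 2 * M = M * (1 - 2^-1)^-1 by field.
rewrite (le_trans (lim_series_norm cn)) //.
rewrite -(cvg_lim _ hg) //; apply: lim_series_le => //.
by apply/cvg_ex; exists (M * (1 - 2^-1)^-1).
Qed.

Lemma normc_coef_le (a : ClC) (M : R) A : cl1 a <= M%:C%C ->
  `|complex.Re (a A)| <= M /\ `|complex.Im (a A)| <= M.
Proof.
move=> h; have := le_trans (cl1_coef a A) h; rewrite normc_def lecR => hA.
by split; apply: le_trans hA; rewrite -sqrtr_sqr ler_sqrt
  ?addr_ge0 ?sqr_ge0 // ?lerDl ?lerDr sqr_ge0.
Qed.

Lemma cl1_ReIm (a : ClC) :
  cl1 a <= (\sum_A (`|complex.Re (a A)| + `|complex.Im (a A)|))%:C%C.
Proof.
rewrite rmorph_sum; apply: ler_sum => A _.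
rewrite normc_def lecR; case: (a A) => x y /=.
rewrite -[leRHS]ger0_norm ?addr_ge0 // -sqrtr_sqr ler_sqrt ?sqr_ge0 //.
rewrite sqrrD !real_normK ?num_real // lerD2r lerDl.
by rewrite mulrn_wge0 // mulr_ge0.
Qed.

(** The real and the imaginary part of each coefficient sum to at most [2 * M], so a coefficient
    contributes at most [4 * M]; the [2 ^ m] coefficients are counted crudely as [2 ^ (2 ^ m)]. *)
Lemma clifford_series_geometric (u : nat -> ClC) (M : R) :
  (forall n, cl1 (u n) <= (M / 2 ^+ n)%:C%C) ->
  exists s, has_sum u s /\ cl1 s <= (2 ^+ (2 ^ m) * 4 * M)%:C%C.
Proof.
move=> hu.
have /choice[x hx] A : exists s, \sum_(i < n) complex.Re (u i A) @[n --> \oo] --> s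
    /\ `|s| <= 2 * M.
  by apply: (@real_series_geometric (fun i => complex.Re (u i A)) M) => n;
    have [] := normc_coef_le A (hu n).
have /choice[y hy] A : exists s, \sum_(i < n) complex.Im (u i A) @[n --> \oo] --> s
    /\ `|s| <= 2 * M.
  by apply: (@real_series_geometric (fun i => complex.Im (u i A)) M) => n;
    have [] := normc_coef_le A (hu n).
have M0 : 0 <= M.
  by have := le_trans (cl1_ge0 _) (hu 0%N); rewrite expr0 divr1 ler0c.
pose s : ClC := mkcl (fun A => (x A +i* y A)%C).
exists s; split; last first.
  rewrite (le_trans (cl1_ReIm s)) // lecR.
  have -> : 2 ^+ (2 ^ m) * 4 * M = 2 ^+ (2 ^ m) * (4 * M) by rewrite mulrA.
  rewrite (@le_trans _ _ (\sum_(A : {set 'I_m}) 4 * M)) //.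
    apply: ler_sum => A _; rewrite mkclE /=.
    by have [_ h1] := hx A; have [_ h2] := hy A; lra.
  rewrite sumr_const -[leLHS]mulr_natl ler_wpM2r ?mulr_ge0 //.
  by rewrite -natrX ler_nat -cardsT -finset.powersetT card_powerset cardsT card_ord
    ltnW // ltn_expl.
(* The l^1 error tends to 0 coefficientwise and squeezes [clnorm] of the remainder. *)
have hc : \sum_A (`|\sum_(i < n) complex.Re (u i A) - x A| +
                 `|\sum_(i < n) complex.Im (u i A) - y A|) @[n --> \oo] --> 0.
  have E0 : \sum_(A : {set 'I_m}) (`|x A - x A| + `|y A - y A|) = 0.
    by rewrite big1 // => A _; rewrite !subrr normr0 addr0.
  rewrite -[X in _ --> X]E0; apply: cvg_big => [|A _]; first exact: add_continuous.
  apply: cvgD.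
    by apply: cvg_norm; apply: cvgB; [exact: (hx A).1|exact: cvg_cst].
  by apply: cvg_norm; apply: cvgB; [exact: (hy A).1|exact: cvg_cst].
apply: (squeeze_cvgr _ (cvg_cst 0) hc).
near=> n; rewrite sqrtr_ge0 /=; apply: clnorm_le; apply: (le_trans (cl1_ReIm _)).
rewrite lecR; apply: ler_sum => A _.
rewrite clcoefD clcoefN clcoef_sum mkclE.
have -> : \sum_(i < n) u i A = ((\sum_(i < n) complex.Re (u i A)) +i*
   (\sum_(i < n) complex.Im (u i A)))%C.
  by elim/big_rec3: _ => // i p q r _ ->; case: (u i A).
by [].
Unshelve. all: by end_near. Qed.

End CliffordReal.

(** * Finite differences *)

Section FiniteDifferences.
Variable R : realType.

Lemma leq_bin_exp2 n k : ('C(n, k) <= 2 ^ n)%N.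
Proof.
elim: n k => [|n IH] [|k]; rewrite ?bin0 ?bin0n ?expn_gt0 //.
by rewrite binS expnS mul2n -addnn leq_add.
Qed.

Lemma expR_ge_term (x : R) n : 0 <= x -> x ^+ n / n`!%:R <= expR x.
Proof.
move=> x0; have -> : x ^+ n / n`!%:R = exp_coeff x n by rewrite /exp_coeff /= mulrC.
have c0 i : 0 <= exp_coeff x i by exact: exp_coeff_ge0.
apply: (@le_trans _ _ (series (exp_coeff x) n.+1)).
  by rewrite /series /= big_nat_recr //= lerDr sumr_ge0.
apply: nondecreasing_cvgn_le; last exact: is_cvg_series_exp_coeff.
by apply/nondecreasing_seqP => i; rewrite /series /= big_nat_recr //= lerDl.
Qed.

Variables (s : R) (n : nat).

(** The operator 1 - (shift by s), applied a times to the e-th power. Terms with b > a vanish; the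
    range is fixed at n so that all orders a use the same lattice. *)
Let fdiff (a e : nat) (t : R) :=
  \sum_(b < n.+1) (-1) ^+ b * 'C(a, b)%:R * (t + s * b%:R) ^+ e.

(** Pascal's rule. The last term of the shifted sum carries 'C(a, n), which vanishes since a < n. *)
Let fdiffS a e t : (a < n)%N -> fdiff a.+1 e t = fdiff a e t - fdiff a e (t + s).
Proof.
move=> an; rewrite /fdiff big_ord_recl [X in _ = X - _]big_ord_recl /= !bin0 -addrA.
congr (_ + _); rewrite [X in _ = _ - X]big_ord_recr /= bin_small // mulr0 mul0r addr0.
rewrite -sumrB; apply: eq_bigr => i _.
rewrite /bump /= add1n binS natrD mulrDr mulrDl; congr (_ + _).
by rewrite exprS mulN1r !mulNr -[in LHS]addn1 natrD mulrDr mulr1 [s * _ + s]addrC addrA.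
Qed.

(** Each difference lowers the degree by one, so a of them kill the powers below a and turn the a-th
    power into a constant. The induction expands the shifted power by the binomial formula. *)
Lemma finite_difference_pow (a e : nat) (t : R) : (e <= a)%N -> (a <= n)%N ->
  \sum_(b < n.+1) (-1) ^+ b * 'C(a, b)%:R * (t + s * b%:R) ^+ e =
  (e == a)%:R * ((-1) ^+ a * a`!%:R * s ^+ a).
Proof.
rewrite -/(fdiff a e t); elim: a e t => [|a IH] e t.
  rewrite leqn0 => /eqP-> _; rewrite /fdiff big_ord_recl /= big1 => [|i _].
    by rewrite !expr0 bin0 fact0 !mulr1 addr0.
  by rewrite bin0n mulr0 mul0r.
move=> ea an; rewrite fdiffS //.
case: e ea => [_|e ea].
  by rewrite !IH ?(ltnW an) // subrr mul0r.
have -> : fdiff a e.+1 t - fdiff a e.+1 (t + s) =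
    - \sum_(i < e.+1) 'C(e.+1, i.+1)%:R * s ^+ i.+1 * fdiff a (e - i) t.
  rewrite -sumrB -sumrN; under [RHS]eq_bigr do rewrite mulr_sumr -sumrN.
  rewrite exchange_big /=; apply: eq_bigr => b _.
  have -> : t + s + s * b%:R = (t + s * b%:R) + s by ring.
  rewrite [(_ + s) ^+ _]exprDn big_ord_recl /= subn0 expr0 mulr1 bin0 mulr1n.
  rewrite mulrDr opprD addNKr mulr_sumr -sumrN; apply: eq_bigr => i _.
  by rewrite /bump /= add1n subSS -mulr_natl; ring.
rewrite big_ord_recl /= subn0 bin1 expr1 IH ?(ltnW an) //.
(* The other powers have degree below e <= a, so the induction hypothesis annihilates them. *)
rewrite big1 => [|i _]; last first.
  rewrite /bump /= add1n IH ?(ltnW an) //; last by rewrite (leq_trans (leq_subr _ _)).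
  rewrite (_ : (e - i.+1)%N == a = false) ?mul0r ?mulr0 //.
  by apply/negbTE; rewrite neq_ltn (@leq_trans e) // ltn_subrL
    (leq_ltn_trans (leq0n i) (ltn_ord i)).
rewrite eqSS addr0; case: eqP => [->|_]; last by rewrite !mul0r mulr0 oppr0.
by rewrite factS natrM !exprS; ring.
Qed.

End FiniteDifferences.

(** * Homogeneous Clifford polynomials *)

Section PolynomialFunctions.
Variable m : nat.

Definition monom (F : comNzRingType) (al : 'I_m -> nat) (x : 'rV[F]_m) : F :=
  \prod_j x ord0 j ^+ al j.

Lemma mmap_monom (R : nzRingType) (F : comNzRingType) (f : R -> clifford F m)
    (p : mpoly.mpoly m R) (x : 'rV[F]_m) :
  mpoly.mmap f (fun j => x ord0 j *: 1) p =
  \sum_(al <- mpoly.msupp p) monom al x *: f (mpoly.mcoeff al p).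
Proof.
apply: eq_bigr => al _; rewrite /mpoly.mmap1.
rewrite (eq_bigr (fun j => x ord0 j ^+ al j *: (1 : clifford F m))).
  by rewrite scaler_prod big1_eq -scalerAr mulr1.
by move=> j _; rewrite exprZn expr1n.
Qed.

Lemma homog_deg (R : nzRingType) k (p : mpoly.mpoly m R) al :
  p \is mpoly.ishomog1 k (@mpoly.mdeg m) -> al \in mpoly.msupp p ->
  (\sum_j al j)%N = k.
Proof. by move=> /mpoly.dhomogP h /h E; rewrite -mpoly.mdegE; exact: E. Qed.

(** Exponents in degree k are at most k, so the support injects into the maps from ['I_m] to
    ['I_k.+1]. *)
Lemma size_msupp_homog (R : nzRingType) k (p : mpoly.mpoly m R) :
  p \is mpoly.ishomog1 k (@mpoly.mdeg m) -> (size (mpoly.msupp p) <= k.+1 ^ m)%N.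
Proof.
move=> hp; pose c (al : mpoly.multinom m) : {ffun 'I_m -> 'I_k.+1} := [ffun j => inord (al j)].
have -> : (k.+1 ^ m)%N = #|{: {ffun 'I_m -> 'I_k.+1}}| by rewrite card_ffun !card_ord.
rewrite -(size_map c) cardE uniq_leq_size //; last by move=> x _; rewrite mem_enum.
rewrite map_inj_in_uniq ?mpoly.msupp_uniq // => al be hal hbe /ffunP E.
apply/mpoly.mnmP => j; have := E j; rewrite !ffunE => /(congr1 val).
have le ga : ga \in mpoly.msupp p -> (ga j < k.+1)%N.
  by move=> /(homog_deg hp) <-; rewrite ltnS (bigD1 j) //= leq_addr.
by rewrite /= !inordK ?le.
Qed.

End PolynomialFunctions.

(** * Coefficients of a homogeneous polynomial from its values on a lattice *)

Section CoefficientExtraction.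
Variables (R : realType) (m k : nat) (p : mpoly.mpoly m (clifford R m)).
Hypothesis hp : p \is mpoly.ishomog1 k (@mpoly.mdeg m).
Local Notation Cl := (clifford R m).

Lemma peval_coef (x : 'rV[R]_m) A : peval p x A =
  \sum_(al <- mpoly.msupp p) monom al x * mpoly.mcoeff al p A.
Proof.
rewrite /peval mmap_monom clcoef_sum.
by apply: eq_bigr => al _; rewrite clcoefZ.
Qed.

Lemma monomZ (c : R) (al : 'I_m -> nat) (x : 'rV[R]_m) :
  monom al (c *: x) = c ^+ (\sum_j al j)%N * monom al x.
Proof.
rewrite /monom -[(\sum_j al j)%N]/(\sum_j al j)%N expr_sum -big_split /=.
by apply: eq_bigr => j _; rewrite mxE exprMn.
Qed.

Lemma pevalZ (c : R) (x : 'rV[R]_m) A : peval p (c *: x) A = c ^+ k * peval p x A.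
Proof.
rewrite !peval_coef mulr_sumr big_seq [RHS]big_seq; apply: eq_bigr => al hal.
by rewrite monomZ (homog_deg hp hal) mulrA.
Qed.

Lemma measurable_monom (al : 'I_m -> nat) :
  measurable_fun [set: 'rV[R]_m] (monom al).
Proof.
rewrite /monom; elim: (index_enum _) => [|j s IH].
  by under eq_fun do rewrite big_nil; exact: measurable_cst.
under eq_fun do rewrite big_cons.
by apply: measurable_funM => //; apply: measurable_funX; exact: measurable_row_coord.
Qed.

Lemma measurable_peval A : measurable_fun [set: 'rV[R]_m] (fun x => peval p x A).
Proof.
under eq_fun do rewrite peval_coef.
apply: measurable_sum => al; apply: measurable_funM => //; exact: measurable_monom.
Qed.

Definition lattice_pt (s : R) (be : {ffun 'I_m -> 'I_k.+1}) : 'rV[R]_m :=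
  \row_j (s * (be j)%:R).

(** The sum factors over the coordinates. Two distinct exponents of equal total degree have a
    coordinate where e is below al, and that factor vanishes. *)
Lemma finite_difference_monom (al e : 'I_m -> nat) (s : R) (x : 'rV[R]_m) :
  (\sum_j al j)%N = k -> (\sum_j e j)%N = k ->
  \sum_(be : {ffun 'I_m -> 'I_k.+1})
     (\prod_j ((-1) ^+ be j * 'C(al j, be j)%:R)) * monom e (x + lattice_pt s be) =
  [forall j, e j == al j]%:R * ((-1) ^+ k * (\prod_j (al j)`!%:R) * s ^+ k).
Proof.
move=> hal he.
transitivity (\prod_j \sum_(b < k.+1)
   (-1) ^+ b * 'C(al j, b)%:R * (x ord0 j + s * b%:R) ^+ e j).
  rewrite bigA_distr_bigA; apply: eq_bigr => be _.
  by rewrite -big_split; apply: eq_bigr => j _; rewrite !mxE.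
have alk j : (al j <= k)%N by rewrite -hal (bigD1 j) //= leq_addr.
have [/forallP E|] := boolP [forall j, e j == al j].
  have Ek (y : R) : y ^+ k = \prod_j y ^+ al j by rewrite -hal expr_sum.
  rewrite mul1r !Ek -!big_split /=; apply: eq_bigr => j _.
  by rewrite finite_difference_pow ?(eqP (E j)) // eqxx mul1r.
rewrite negb_forall => /existsP[j nj]; rewrite mul0r.
have [i ei] : exists i, (e i < al i)%N.
  apply/existsP; apply: contraT; rewrite negb_exists => /forallP hge.
  have : (\sum_j al j < \sum_j e j)%N.
    rewrite (bigD1 j) //= [X in (_ < X)%N](bigD1 j) //= -addSn leq_add //.
      by rewrite ltn_neqAle eq_sym nj leqNgt hge.
    by apply: leq_sum => i _; rewrite leqNgt hge.
  by rewrite hal he ltnn.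
by rewrite (bigD1 i) //= finite_difference_pow ?(ltnW ei) // ltn_eqF // !mul0r.
Qed.

(** The mixed difference of order al annihilates every other monomial of degree k and isolates the
    coefficient. Its binomial weights are at most the product of the [2 ^+ al j], that is
    [2 ^+ k]. *)
Lemma coef_le_lattice (al : mpoly.multinom m) A (s : R) (x : 'rV[R]_m) :
  al \in mpoly.msupp p -> 0 <= s ->
  `|mpoly.mcoeff al p A| * (\prod_j (al j)`!%:R * s ^+ k) <=
  2 ^+ k * \sum_(be : {ffun 'I_m -> 'I_k.+1}) `|peval p (x + lattice_pt s be) A|.
Proof.
move=> hal s0; have hk := homog_deg hp hal.
have E : \sum_(be : {ffun 'I_m -> 'I_k.+1})
     (\prod_j ((-1) ^+ be j * 'C(al j, be j)%:R)) * peval p (x + lattice_pt s be) A =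
   (-1) ^+ k * (\prod_j (al j)`!%:R) * s ^+ k * mpoly.mcoeff al p A.
  under [LHS]eq_bigr do rewrite peval_coef mulr_sumr.
  rewrite [LHS]exchange_big /= (bigD1_seq al) ?mpoly.msupp_uniq //= [X in _ + X]big_seq_cond.
  rewrite [X in _ + X]big1 => [|ga /andP[hga nga]]; last first.
    under [LHS]eq_bigr do rewrite mulrA; rewrite -mulr_suml.
    rewrite finite_difference_monom ?(homog_deg hp hga) //.
    rewrite (_ : [forall j, _] = false) ?mul0r //.
    by apply: contra_neqF nga => /forallP h; apply/mpoly.mnmP => j; exact/eqP.
  under [X in X + _]eq_bigr do rewrite mulrA; rewrite -mulr_suml finite_difference_monom //.
  rewrite (_ : [forall j, _] = true) ?mul1r ?addr0 //.
  by apply/forallP.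
have f0 : 0 <= \prod_j (al j)`!%:R :> R by apply: prodr_ge0.
have -> : `|mpoly.mcoeff al p A| * (\prod_j (al j)`!%:R * s ^+ k) =
   `|(-1) ^+ k * (\prod_j (al j)`!%:R) * s ^+ k * mpoly.mcoeff al p A|.
  rewrite !normrM normrX normrN1 expr1n mul1r (ger0_norm f0) ger0_norm ?exprn_ge0 //.
  by rewrite mulrC.
rewrite -E (le_trans (ler_norm_sum _ _ _)) // mulr_sumr.
apply: ler_sum => be _; rewrite normrM ler_wpM2r // normr_prod.
have -> : (2 : R) ^+ k = \prod_j 2 ^+ al j by rewrite -expr_sum hk.
apply: ler_prod => j _; rewrite normr_ge0 /=.
rewrite normrM normrX normrN1 expr1n mul1r normr_nat -natrX ler_nat.
exact: leq_bin_exp2.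
Qed.

End CoefficientExtraction.

(** * From the sphere to the ball *)

Section SphereBound.
Variables (R : realType) (m : nat).
Hypothesis hm : (0 < m)%N.
Local Notation lam := (lebesgue_row R m).
Local Notation ball := (@punctured_ball R m).

Lemma measurable_unit_sphere : measurable (@unit_sphere R m).
Proof.
have -> : @unit_sphere R m = @enorm R m @^-1` [set 1] by apply/seteqP; split.
by rewrite -[X in measurable X]setTI; exact: measurable_enorm.
Qed.

Lemma enormZ (c : R) (x : 'rV[R]_m) : enorm (c *: x) = `|c| * enorm x.
Proof.
rewrite /enorm -sqrtr_sqr -sqrtrM ?sqr_ge0 // mulr_sumr.
by congr Num.sqrt; apply: eq_bigr => j _; rewrite mxE exprMn.
Qed.

(** By the cone formula the sphere measure is m times the image of the volume of the punctured ball
    under [normalize]; the factor m >= 1 is given away. *)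
Lemma integral_ball_le_sphere (h : 'rV[R]_m -> \bar R) :
  measurable_fun setT h -> (forall x, (0 <= h x)%E) ->
  (\int[lam]_(x in ball) h (normalize x) <=
   \int[@sphere_measure R m]_(x in @unit_sphere R m) h x)%E.
Proof.
move=> mh h0; have mS := measurable_unit_sphere.
have mhS : measurable_fun (@unit_sphere R m) h by exact: measurable_funTS.
rewrite [leRHS]ge0_integral_mscale //.
rewrite (@ge0_integral_pushforward _ _ _ _ _ _ (@measurable_normalize R m)) //.
have mhn : measurable_fun setT (fun x : 'rV[R]_m => h (normalize x)).
  exact: (measurableT_comp mh (@measurable_normalize R m)).
have mB := @measurable_punctured_ball R m.
have mE : measurable (@normalize R m @^-1` (@unit_sphere R m)).
  by rewrite -[X in measurable X]setTI; exact: measurable_normalize.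
apply: (@le_trans _ _ (\int[mrestr lam mB]_(x in @normalize R m @^-1` (@unit_sphere R m))
    h (normalize x))%E).
  rewrite (@eq_measure_integral _ _ _ ball (mrestr lam mB)); last first.
    by move=> A mA AB; rewrite /= /mrestr setIidl.
  apply: ge0_subset_integral => //; first exact: measurable_funTS.
  move=> x /andP[x0 x1]; rewrite /unit_sphere /= enormZ ger0_norm ?invr_ge0 ?ltW //.
  by rewrite mulVf // gt_eqF.
rewrite lee_pemull //; first exact: integral_ge0.
by rewrite lee_fin ler1n.
Qed.

(* The value of sphere_area is irrelevant: the normalisation forces it to equal
   the sphere integral, and excludes a divergent one, for which fine +oo = 0. *)
Lemma ball_mean_square k (p : mpoly.mpoly m (clifford R m)) A :
  p \is mpoly.ishomog1 k (@mpoly.mdeg m) ->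
  sphere_inner (peval p) (peval p) = 1 ->
  (\int[lam]_(x in ball) (peval p x A ^+ 2)%:E <= `|sphere_area R m|%:E)%E.
Proof.
move=> hp /(congr1 (fun a : clifford R m => a finset.set0)).
rewrite clcoefZ [in RHS]mkclE eqxx mkclE => E.
set I := (X in _ * X = _) in E.
have a0 : sphere_area R m != 0.
  by apply/eqP => a0; move: E => /eqP; rewrite a0 invr0 mul0r eq_sym oner_eq0.
have {}E : I = sphere_area R m by apply: (mulfI (invr_neq0 a0)); rewrite E mulVf.
have I0 : I != 0 by rewrite E.
pose h (x : 'rV[R]_m) : \bar R := (\sum_B peval p x B ^+ 2)%:E.
have hE : I%:E = (\int[@sphere_measure R m]_(x in @unit_sphere R m) h x)%E.
  have IE : I = fine (\int[@sphere_measure R m]_(x in @unit_sphere R m) h x)%E.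
    by congr fine; apply: eq_integral => x _; rewrite clconj_mul0.
  rewrite IE fineK // ge0_fin_numE; last first.
    by apply: integral_ge0 => x _; rewrite lee_fin sumr_ge0 // => B _; exact: sqr_ge0.
  by rewrite ltey; apply: contra_neq I0 => oo; rewrite IE oo.
have mh : measurable_fun setT h.
  apply/measurable_EFinP; apply: measurable_sum => B.
  by apply: measurable_funX; exact: measurable_peval.
have h0 x : (0 <= h x)%E by rewrite lee_fin sumr_ge0 // => B _; exact: sqr_ge0.
apply: (@le_trans _ _ I%:E); last by rewrite E lee_fin ler_norm.
rewrite hE; apply: le_trans (integral_ball_le_sphere mh h0).
apply: ge0_le_integral.
- exact: measurable_punctured_ball.
- by move=> x _; rewrite lee_fin sqr_ge0.
- apply: measurable_funTS; apply/measurable_EFinP.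
  by apply: measurable_funX; exact: measurable_peval.
- apply: measurable_funTS.
  exact: (measurableT_comp mh (@measurable_normalize R m)).
- move=> x /andP[x0 x1]; rewrite lee_fin.
  (* By homogeneity the value at x is the value on the sphere times a radial factor at most 1. *)
  have -> : peval p x A ^+ 2 = (enorm x ^+ k) ^+ 2 * peval p (normalize x) A ^+ 2.
    by rewrite -exprMn -(pevalZ hp) /normalize scalerA mulfV ?scale1r // gt_eqF.
  rewrite (bigD1 A) //=; apply: (@le_trans _ _ (peval p (normalize x) A ^+ 2)).
    by rewrite ler_piMl ?sqr_ge0 // -exprM exprn_ile1 // ltW.
  by rewrite lerDl sumr_ge0 // => B _; exact: sqr_ge0.
Qed.

End SphereBound.

(** * Averaging the lattice over a small cube inside the ball *)

Section CoefficientBound.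
Variables (R : realType) (m : nat).
Hypothesis hm : (0 < m)%N.
Local Notation lam := (lebesgue_row R m).
Local Notation ball := (@punctured_ball R m).
Local Notation cube d := [set x : 'rV[R]_m | forall j, 0 < x ord0 j <= d].

(** A cube of side d shifted by lattice points of coordinates at most d has coordinates in ]0, 1/m],
    so it stays in the unit ball. *)
Let d : R := (2 * m%:R)^-1.

(** Extend G by zero outside B and use translation invariance on the whole space. *)
Lemma integral_subset_translation (A B : set 'rV[R]_m) (w : 'rV[R]_m)
    (G : 'rV[R]_m -> \bar R) :
  measurable A -> measurable B -> measurable_fun setT G -> (forall x, (0 <= G x)%E) ->
  (forall x, A x -> B (x + w)) ->
  (\int[lam]_(x in A) G (x + w)%R <= \int[lam]_(x in B) G x)%E.
Proof.
move=> mA mB mG G0 AB.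
have mGB : measurable_fun setT (G \_ B).
  by apply/(measurable_restrictT _ mB); exact: measurable_funTS.
have GB0 x : (0 <= (G \_ B) x)%E by rewrite patchE; case: ifP.
rewrite [leRHS]integral_mkcond -(@ge0_integral_row_translation R m w (G \_ B) mGB GB0).
have mGw : measurable_fun setT (fun x : 'rV[R]_m => (G \_ B) (x + w)).
  exact: (measurableT_comp mGB (@measurable_row_add R m w)).
apply: (@le_trans _ _ (\int[lam]_(x in A) (G \_ B) (x + w)%R)%E).
  rewrite le_eqVlt; apply/orP; left; apply/eqP; apply: eq_integral => x /[!inE] Ax.
  by rewrite patchE mem_set //; exact: AB.
by apply: ge0_subset_integral => // x _; exact: GB0.
Qed.

Lemma cube_add_in_ball (k : nat) (x : 'rV[R]_m) (be : {ffun 'I_m -> 'I_k.+1}) :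
  cube d x -> ball (x + lattice_pt (d / k.+1%:R) be).
Proof.
move=> hx.
have m0 : 0 < m%:R :> R by rewrite ltr0n.
have d0 : 0 < d by rewrite invr_gt0 mulr_gt0.
pose y := x + lattice_pt (d / k.+1%:R) be.
have hy j : 0 < y ord0 j <= m%:R^-1.
  have /andP[x0 xd] := hx j; rewrite !mxE.
  have b0 : 0 <= d / k.+1%:R * (be j)%:R by rewrite mulr_ge0 // mulr_ge0 ?invr_ge0 // ltW.
  (* The mesh is [d / k.+1%:R] and the indices are at most k, so no shift exceeds d. *)
  have bd : d / k.+1%:R * (be j)%:R <= d.
    rewrite -mulrA ler_piMr ?(ltW d0) // mulrC ler_pdivrMr // mul1r ler_nat.
    exact: ltnW.
  have -> : m%:R^-1 = d + d by rewrite /d invfM; field; rewrite gt_eqF.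
  by rewrite lerD // andbT ltr_wpDr.
have y0 j : 0 <= y ord0 j by have /andP[/ltW] := hy j.
rewrite /punctured_ball /= -/y /enorm; apply/andP; split.
  rewrite sqrtr_gt0; have j : 'I_m by exact: Ordinal hm.
  rewrite (bigD1 j) //= ltr_pwDl ?sumr_ge0 // => [|i _]; last exact: sqr_ge0.
  by rewrite exprn_gt0 //; have /andP[] := hy j.
rewrite -(sqrtr1 R) ler_sqrt //.
have -> : 1 = \sum_(j < m) (m%:R^-1 : R).
  by rewrite sumr_const card_ord -[LHS](@mulVf _ (m%:R : R)) ?gt_eqF // mulr_natr.
apply: ler_sum => j _; have /andP[_ h] := hy j.
rewrite expr2 (le_trans _ h) // ler_piMl // (le_trans h) // invf_le1 // ler1n //.
Qed.

(** [coef_le_lattice] is integrated in x over the cube of volume [d ^+ m]. Each of the [k.+1 ^ m]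
    translates of the cube lies in the ball and contributes at most W; [1 + g ^+ 2] dominates [|g|],
    so square integrals suffice. *)
Lemma coef_ball_bound k (p : mpoly.mpoly m (clifford R m)) (al : mpoly.multinom m) A (W : R) :
  p \is mpoly.ishomog1 k (@mpoly.mdeg m) -> al \in mpoly.msupp p ->
  (\int[lam]_(x in ball) (1 + peval p x A ^+ 2)%:E <= W%:E)%E ->
  `|mpoly.mcoeff al p A| * (\prod_j (al j)`!%:R * (d / k.+1%:R) ^+ k) * d ^+ m <=
  2 ^+ k * (k.+1 ^ m)%:R * W.
Proof.
move=> hp hal hW; set s := d / k.+1%:R.
have d0 : 0 < d by rewrite invr_gt0 mulr_gt0 // ltr0n.
have s0 : 0 <= s by rewrite mulr_ge0 ?invr_ge0 // ltW.
set c0 := _ * (_ * _).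
have mQ := @measurable_row_cube R m d.
pose G (x : 'rV[R]_m) : \bar R := (1 + peval p x A ^+ 2)%:E.
have mG : measurable_fun setT G.
  apply/measurable_EFinP; apply: measurable_funD => //; apply: measurable_funX.
  exact: measurable_peval.
have G0 x : (0 <= G x)%E by rewrite lee_fin addr_ge0 ?sqr_ge0.
have mGw w : measurable_fun (cube d) (fun x : 'rV[R]_m => G (x + w)).
  by apply: measurable_funTS; exact: (measurableT_comp mG (@measurable_row_add R m w)).
have mS : measurable_fun (cube d) (fun x : 'rV[R]_m =>
    (\sum_(be : {ffun 'I_m -> 'I_k.+1}) G (x + lattice_pt s be)%R)%E).
  exact: (@emeasurable_sum _ _ _ _ _ _ (fun be (x : 'rV[R]_m) => G (x + lattice_pt s be))).
rewrite -lee_fin EFinM -lebesgue_row_cube //.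
rewrite -[leLHS](integral_cst lam mQ).
apply: (@le_trans _ _ (\int[lam]_(x in cube d)
   ((2 ^+ k)%:E * \sum_(be : {ffun 'I_m -> 'I_k.+1}) G (x + lattice_pt s be)%R))%E).
  apply: ge0_le_integral => //.
  - by move=> x _; rewrite lee_fin !mulr_ge0 ?prodr_ge0 ?exprn_ge0.
  - apply: emeasurable_funM; [exact: measurable_cst|exact: mS].
  - move=> x _; rewrite sumEFin -EFinM lee_fin (le_trans (coef_le_lattice hp A x hal s0)) //.
    rewrite ler_wpM2l ?exprn_ge0 //; apply: ler_sum => be _.
    set g := peval _ _ _; rewrite -[g ^+ 2]real_normK ?num_real //.
    have := sqr_ge0 (`|g| - 1); have := normr_ge0 g; nra.
rewrite ge0_integralZl //; last by move=> x _; apply: sume_ge0 => be _; exact: G0.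
rewrite ge0_integral_sum // -mulrA EFinM; apply: lee_wpmul2l.
  by rewrite lee_fin exprn_ge0.
apply: (@le_trans _ _ (\sum_(be : {ffun 'I_m -> 'I_k.+1}) W%:E)%E).
  apply: lee_sum => be _; apply: le_trans hW.
  apply: integral_subset_translation => //; first exact: measurable_punctured_ball.
  by move=> x; exact: cube_add_in_ball.
by rewrite sumEFin sumr_const card_ffun !card_ord mulr_natl.
Qed.

(** The integrable Gaussian is at least exp(-1/4) on the unit ball. *)
Lemma ball_volume_fin : (lam ball < +oo)%E.
Proof.
have mB := @measurable_punctured_ball R m.
rewrite -[X in (X < _)%E]mul1e -(integral_cst lam mB 1%E).
apply: (@le_lt_trans _ _ (\int[lam]_x ((expR (1 / 4))%:E * (expR (- (enorm x ^+ 2 / 4)))%:E))%E).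
  have mg : measurable_fun setT (fun x : 'rV[R]_m => (expR (- (enorm x ^+ 2 / 4)))%:E).
    by apply/measurable_EFinP; exact: measurable_row_gauss4.
  have mg' : measurable_fun setT (fun x : 'rV[R]_m =>
      ((expR (1 / 4))%:E * (expR (- (enorm x ^+ 2 / 4)))%:E)%E).
    by apply: emeasurable_funM => //; exact: measurable_cst.
  apply: (@le_trans _ _ (\int[lam]_(x in ball)
      ((expR (1 / 4))%:E * (expR (- (enorm x ^+ 2 / 4)))%:E))%E).
    apply: ge0_le_integral => //.
      exact: measurable_funTS.
    move=> x /andP[x0 x1]; rewrite -EFinM lee_fin -expRD -[leLHS]expR0 ler_expR.
    have : enorm x ^+ 2 <= 1 by rewrite exprn_ile1 // ltW.
    lra.
  exact: ge0_subset_integral.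
rewrite ge0_integralZl //; last first.
  by apply/measurable_EFinP; exact: measurable_row_gauss4.
by rewrite lte_mul_pinfty ?integral_row_gauss4_fin.
Qed.

End CoefficientBound.

(** * Exponential growth of the coefficients of normalised polynomials *)

Section UniformCoefficientBound.
Variables (R : realType) (m : nat).
Hypothesis hm : (0 < m)%N.
Local Notation lam := (lebesgue_row R m).
Local Notation ball := (@punctured_ball R m).

(** The ball volume plus the bound of [ball_mean_square]; the summand 1 makes the powers of W
    nondecreasing. *)
Let W : R := 1 + fine (lam ball) + `|sphere_area R m|.

Let W1 : 1 <= W.
Proof. by rewrite /W -addrA lerDl addr_ge0 // fine_ge0. Qed.

Lemma integral_ball_bound k (p : mpoly.mpoly m (clifford R m)) A :
  p \is mpoly.ishomog1 k (@mpoly.mdeg m) ->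
  sphere_inner (peval p) (peval p) = 1 ->
  (\int[lam]_(x in ball) (1 + peval p x A ^+ 2)%:E <= W%:E)%E.
Proof.
move=> hp p1; have mB := @measurable_punctured_ball R m.
under eq_integral do rewrite EFinD.
rewrite ge0_integralD //; last 2 first.
- by move=> x _; rewrite lee_fin sqr_ge0.
- apply: measurable_funTS; apply/measurable_EFinP; apply: measurable_funX.
  exact: measurable_peval.
rewrite EFinD leeD ?(ball_mean_square hm A hp p1) //.
rewrite (integral_cst lam mB 1%E) mul1e EFinD fineK ?leeDr //.
rewrite ge0_fin_numE //; exact: ball_volume_fin.
Qed.

(** In each coordinate, (k+1)^(al j) / (al j)! is a term of the series of exp(k+1). This compensates
    the k-th power of the mesh, of order (k+1)^(-k), by the factorials. *)
Lemma pow_le_fact_expR k (al : 'I_m -> nat) : (\sum_j al j)%N = k ->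
  k.+1%:R ^+ k <= \prod_j (al j)`!%:R * expR m%:R ^+ k.+1 :> R.
Proof.
move=> hk; rewrite -{2}hk expr_sum.
have -> : expR m%:R ^+ k.+1 = \prod_(j < m) expR k.+1%:R :> R.
  by rewrite prodr_const card_ord -!expRM_natl mulrC.
rewrite -big_split /=; apply: ler_prod => j _; rewrite exprn_ge0 //=.
have f0 : 0 < (al j)`!%:R :> R by rewrite ltr0n fact_gt0.
by rewrite mulrC -ler_pdivrMr // expR_ge_term.
Qed.

(** Solving [coef_ball_bound] for the coefficient costs (k+1)^k divided by the factorials, at most
    [E ^+ k.+1]; the remaining factors grow at most exponentially in k. The extra T in the constant
    pays for the [2 ^ m] blades and, through [kT], for the number of monomials. *)
Lemma coef_l1_bound : exists2 C : R, 1 <= C &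
  forall k (p : mpoly.mpoly m (clifford R m)),
  p \is mpoly.ishomog1 k (@mpoly.mdeg m) ->
  sphere_inner (peval p) (peval p) = 1 ->
  \sum_(al <- mpoly.msupp p) cl1 (mpoly.mcoeff al p) <= C ^+ k.+1.
Proof.
pose D : R := 2 * m%:R; pose E : R := expR m%:R.
have D1 : 1 <= D by rewrite /D -natrM ler1n muln_gt0.
have E1 : 1 <= E by rewrite -expR0 ler_expR.
pose T : R := 2 ^+ m.
have T1 : 1 <= T by rewrite exprn_ege1 // ler1n.
have g1 (a b : R) : 1 <= a -> 1 <= b -> 1 <= a * b.
  by move=> a1 b1; rewrite -[1]mulr1 ler_pM.
(* All factors are at least 1, so [C ^+ k.+1] absorbs lower powers; for instance [D ^+ (k + m)] is
   at most [(D ^+ m.+1) ^+ k.+1]. *)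
pose C := D ^+ m.+1 * 2 * T * W * E.
have C1 : 1 <= C by rewrite /C !g1 ?exprn_ege1 ?ler1n.
exists (T * C); first exact: g1.
move=> k p hp p1.
have kT : (k.+1 ^ m)%:R <= T ^+ k.
  rewrite natrX -exprM mulnC exprM lerXn2r ?nnegrE ?exprn_ge0 //.
  by rewrite -natrX ler_nat ltn_expl.
have coefC al A : al \in mpoly.msupp p -> `|mpoly.mcoeff al p A| <= C ^+ k.+1.
  move=> hal; have hk := homog_deg hp hal.
  have := coef_ball_bound hm hp hal (integral_ball_bound A hp p1).
  rewrite -/D; set c := `|_|; set f := \prod_j _ => h; clearbody D.
  have f0 : 0 < f by apply: prodr_gt0 => j _; rewrite ltr0n fact_gt0.
  have hf : k.+1%:R ^+ k <= f * E ^+ k.+1 := pow_le_fact_expR hk.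
  have D0 : 0 < D by exact: lt_le_trans D1.
  have c0 : 0 <= c by exact: normr_ge0.
  have k0 : 0 < k.+1%:R ^+ k :> R by rewrite exprn_gt0.
  have h2 : c * f <= D ^+ (k + m) * 2 ^+ k * T ^+ k * W * (f * E ^+ k.+1).
    apply: (@le_trans _ _ (D ^+ (k + m) * 2 ^+ k * (k.+1 ^ m)%:R * W * k.+1%:R ^+ k)).
      have -> : c * f = D ^+ (k + m) * k.+1%:R ^+ k *
          (c * (f * (D^-1 / k.+1%:R) ^+ k) * D^-1 ^+ m).
        have aux (a b n : R) : a != 0 -> b != 0 -> n != 0 ->
          c * f = a * b * n * (c * (f * (a^-1 * n^-1)) * b^-1).
          by move=> a0 b0 n0; field; rewrite a0 b0 n0.
        by rewrite exprMn !exprVn exprD; apply: aux; rewrite expf_neq0 ?gt_eqF.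
      rewrite [leRHS](_ : _ = D ^+ (k + m) * k.+1%:R ^+ k * (2 ^+ k * (k.+1 ^ m)%:R * W)).
        by rewrite ler_wpM2l // mulr_ge0 ?exprn_ge0 // ltW.
      by ring.
    have p0 : 0 <= D ^+ (k + m) * 2 ^+ k by rewrite mulr_ge0 ?exprn_ge0 // ltW.
    have W0 : 0 <= W by exact: le_trans W1.
    have q1 : 0 <= D ^+ (k + m) * 2 ^+ k * (k.+1 ^ m)%:R * W by rewrite mulr_ge0 // mulr_ge0.
    have q2 := ltW k0.
    by apply: ler_pM => //; rewrite ler_wpM2r // ler_wpM2l.
  have {}h2 : c <= D ^+ (k + m) * 2 ^+ k * T ^+ k * W * E ^+ k.+1.
    by rewrite -(ler_pM2r f0) (le_trans h2) // le_eqVlt; apply/orP; left; apply/eqP; ring.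
  rewrite (le_trans h2) // /C !exprMn -[(D ^+ m.+1) ^+ _]exprM.
  have ex (a : R) n n' : 1 <= a -> (n <= n')%N -> 0 <= a ^+ n <= a ^+ n'.
    by move=> a1 nn; rewrite exprn_ge0 ?(le_trans _ a1) // ler_weXn2l.
  have pM (a b a' b' : R) : 0 <= a <= a' -> 0 <= b <= b' -> 0 <= a * b <= a' * b'.
    by move=> /andP[a0 aa] /andP[b0 bb]; rewrite mulr_ge0 // ler_pM.
  suff /andP[] : 0 <= D ^+ (k + m) * 2 ^+ k * T ^+ k * W * E ^+ k.+1 <=
    D ^+ (m.+1 * k.+1) * 2 ^+ k.+1 * T ^+ k.+1 * W ^+ k.+1 * E ^+ k.+1 by [].
  apply: (pM _ _ _ _); last exact: ex.
  apply: (pM _ _ _ _); last by apply: (ex _ 1%N).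
  apply: (pM _ _ _ _); last exact: ex.
  apply: (pM _ _ _ _); last by apply: (ex _ _ _) => //; rewrite ler1n.
  by apply: (ex _ _ _) => //; rewrite mulSn mulnS addSn leqW // leq_add // leq_addr.
clearbody C.
apply: (@le_trans _ _ (\sum_(al <- mpoly.msupp p) T * C ^+ k.+1)).
  rewrite big_seq [leRHS]big_seq; apply: ler_sum => al hal.
  rewrite (@le_trans _ _ (\sum_(A : {set 'I_m}) C ^+ k.+1)) //.
    by apply: ler_sum => A _; exact: coefC.
  rewrite sumr_const -finset.cardsT -finset.powersetT card_powerset finset.cardsT card_ord.
  by rewrite -[leLHS]mulr_natl natrX.
rewrite big_const_seq count_predT iter_addr addr0 -[leLHS]mulr_natl.
rewrite exprMn mulrA ler_wpM2r ?exprn_ge0 ?(le_trans _ C1) // exprSr.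
rewrite ler_wpM2r ?(le_trans _ T1) // (le_trans _ kT) // ler_nat.
exact: size_msupp_homog.
Qed.

End UniformCoefficientBound.

(** * The Dirac operator on Gaussian times polynomial *)

Section HermiteBound.
Variables (R : realType) (m : nat).
Local Notation Cl := (clifford R m).
Implicit Types (al : 'I_m -> nat) (x : 'rV[R]_m).

Definition mdegf al : nat := \sum_j al j.
Definition minc al (j : 'I_m) : 'I_m -> nat := fun i => (al i + (i == j))%N.
(** At a zero exponent the truncated subtraction leaves al unchanged; the derivative then carries
    the coefficient 0. *)
Definition mdec al (j : 'I_m) : 'I_m -> nat := fun i => (al i - (i == j))%N.

Lemma mdegf_inc al j : mdegf (minc al j) = (mdegf al).+1.
Proof.
rewrite /mdegf /minc big_split /= -addn1; congr (_ + _)%N.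
by rewrite (bigD1 j) //= eqxx big1 // => i /negbTE->.
Qed.

Lemma mdegf_dec al j : (0 < al j)%N -> mdegf al = (mdegf (mdec al j)).+1.
Proof.
move=> a0; rewrite -(mdegf_inc _ j); apply: eq_bigr => i _.
by rewrite /minc /mdec; case: eqP => [->|_] /=; rewrite ?subn0 ?addn0 // subnK.
Qed.

Lemma monom_inc al j x : monom (minc al j) x = x ord0 j * monom al x.
Proof.
rewrite /monom (bigD1 j) //= [in RHS](bigD1 j) //= mulrA; congr (_ * _).
  by rewrite /minc eqxx addn1 exprS.
by apply: eq_bigr => i /negbTE ij; rewrite /minc ij addn0.
Qed.

Definition gauss x : R := expR (- (enorm x ^+ 2 / 2)).

(** On the line through x in direction j the function is the exponential of a quadratic polynomial
    times a polynomial in one variable, to which polynomial calculus applies. *)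
Lemma is_derive_gauss_monom al j x :
  is_derive x (delta_mx ord0 j : 'rV[R]_m) (fun y => gauss y * monom al y)
    (gauss x * ((al j)%:R * monom (mdec al j) x - x ord0 j * monom al x)).
Proof.
pose S : R := \sum_(i | i != j) x ord0 i ^+ 2.
pose K : R := \prod_(i | i != j) x ord0 i ^+ al i.
pose g (t : R) : R := expR (- (((t + x ord0 j) ^+ 2 + S) / 2)) * ((t + x ord0 j) ^+ al j * K).
have gE t : gauss (t *: (delta_mx ord0 j) + x) * monom al (t *: (delta_mx ord0 j) + x) = g t.
  have co i : (t *: (delta_mx ord0 j : 'rV[R]_m) + x) ord0 i =
      if i == j then t + x ord0 j else x ord0 i.
    by rewrite !mxE eqxx /=; case: eqP => [->|_]; rewrite ?mulr1 // mulr0 add0r.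
  move: (t *: _ + x) co => y co; rewrite /g /gauss.
  have -> : enorm y ^+ 2 = (t + x ord0 j) ^+ 2 + S.
    rewrite enorm2 (bigD1 j) //= co eqxx; congr (_ + _).
    by apply: eq_bigr => i /negbTE ij; rewrite co ij.
  congr (_ * _); rewrite /monom (bigD1 j) //= co eqxx; congr (_ * _).
  by apply: eq_bigr => i /negbTE ij; rewrite co ij.
pose dg : R := gauss x * ((al j)%:R * monom (mdec al j) x - x ord0 j * monom al x).
suff [dg1 dg2] : is_derive (0 : R) (1 : R) g dg.
  (* The difference quotients at x in direction j are those of g at 0, so derivability and the value
     both transfer. *)
  have E : (fun h : R => h^-1 *: (((fun y => gauss y * monom al y) \o shift x)
      (h *: (delta_mx ord0 j))
      - gauss x * monom al x)) = (fun h : R => h^-1 *: ((g \o shift 0) (h *: (1 : R)) - g 0)).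
    apply/funext => h /=; rewrite gE.
    have -> : gauss x * monom al x = g 0 by rewrite -gE scale0r add0r.
    by rewrite addr0 /GRing.scale /= mulr1.
  by split; rewrite /derivable /derive E.
pose q : {poly R} := - (2^-1)%:P * (('X + (x ord0 j)%:P) ^+ 2 + S%:P).
pose p : {poly R} := ('X + (x ord0 j)%:P) ^+ al j * K%:P.
have -> : g = (expR \o horner q) * horner p.
  apply/funext => t; rewrite [RHS](_ : _ = expR q.[t] * p.[t]) // /g.
  congr (expR _ * _); last by rewrite /p !hornerE.
  by rewrite /q !hornerE; ring.
have hq := is_derive_poly q 0.
have hE : is_derive (0 : R) (1 : R) (expR \o horner q) (expR q.[0] * q^`().[0]).
  exact: is_derive1_comp.
apply: (is_derive_eq (is_deriveM hE (is_derive_poly p 0))).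
have q0 : expR q.[0] = gauss x.
  rewrite /q /gauss enorm2 (bigD1 j) //= -/S; congr expR; rewrite !hornerE; ring.
have p0 : p.[0] = monom al x by rewrite /p !hornerE /monom (bigD1 j).
have dq0 : q^`().[0] = - x ord0 j.
  rewrite /q !(derivM, derivD, derivN, derivC, derivX, deriv_exp) !hornerE /=; by field.
have dp0 : p^`().[0] = (al j)%:R * monom (mdec al j) x.
  rewrite /p derivM derivC mulr0 addr0 deriv_exp derivD derivX derivC addr0 mul1r.
  rewrite hornerM hornerMn !hornerE -mulr_natl -mulrA; congr (_ * _).
  rewrite /monom (bigD1 j) //= /mdec eqxx subn1; congr (_ * _).
  by apply: eq_bigr => i /negbTE ->; rewrite subn0.
transitivity (gauss x *: p^`().[0] + p.[0] *: (gauss x * q^`().[0])); first by rewrite -q0.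
rewrite p0 dq0 dp0 /dg /GRing.scale /=; ring.
Qed.

(* A list of pairs (exponent, coefficient) stands for a polynomial; exponents
   may be repeated. *)
Definition leval (s : seq (('I_m -> nat) * Cl)) x : Cl :=
  \sum_(t <- s) monom t.1 x *: t.2.

(** The Dirac operator conjugated by the Gaussian: q is sent to D q - x q, x being the Clifford
    vector. The [mdec] entries come from differentiating the monomial, the [minc] entries from the
    Gaussian. *)
Definition hstep (s : seq (('I_m -> nat) * Cl)) :=
  flatten [seq flatten [seq [:: (mdec t.1 j, (t.1 j)%:R *: (clgen j * t.2));
                                (minc t.1 j, - (clgen j * t.2))] | j <- enum 'I_m] | t <- s].

Lemma leval_cons t s x : leval (t :: s) x = monom t.1 x *: t.2 + leval s x.
Proof. exact: big_cons. Qed.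

Lemma leval_cat s1 s2 x : leval (s1 ++ s2) x = leval s1 x + leval s2 x.
Proof. exact: big_cat. Qed.

Lemma leval_flatten I (r : seq I) (F : I -> seq (('I_m -> nat) * Cl)) x :
  leval (flatten [seq F i | i <- r]) x = \sum_(i <- r) leval (F i) x.
Proof.
elim: r => [|i r IH] /=; first by rewrite /leval !big_nil.
by rewrite leval_cat IH big_cons.
Qed.

Lemma is_derive_gauss_leval s j A x :
  is_derive x (delta_mx ord0 j : 'rV[R]_m) (fun y => (gauss y *: leval s y) A)
    (\sum_(t <- s) gauss x * ((t.1 j)%:R * monom (mdec t.1 j) x - x ord0 j * monom t.1 x) * t.2 A).
Proof.
have -> : (fun y => (gauss y *: leval s y) A) =
    (fun y => \sum_(t <- s) (gauss y * monom t.1 y) * t.2 A).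
  apply/funext => y; rewrite clcoefZ /leval clcoef_sum mulr_sumr.
  by apply: eq_bigr => t _; rewrite clcoefZ mulrA.
elim: s => [|t s IH].
  by under eq_fun do rewrite big_nil; rewrite big_nil; exact: is_derive_cst.
under eq_fun do rewrite big_cons; rewrite big_cons.
apply: is_deriveD; rewrite mulrC.
have -> : (fun y => gauss y * monom t.1 y * t.2 A) = (t.2 A) *: (fun y => gauss y * monom t.1 y).
  by apply/funext => y; rewrite mulrC.
exact: (is_deriveZ (t.2 A) (is_derive_gauss_monom t.1 j x)).
Qed.

Lemma dirac_gauss_leval s x :
  dirac_op (fun y => gauss y *: leval s y) x = gauss x *: leval (hstep s) x.
Proof.
rewrite leval_flatten scaler_sumr.
transitivity (\sum_(j : 'I_m) \sum_(t <- s)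
   gauss x *: (((t.1 j)%:R * monom (mdec t.1 j) x - x ord0 j * monom t.1 x) *: (clgen j * t.2))).
  apply: eq_bigr => j _.
  have -> : partial j (fun y => gauss y *: leval s y) x = \sum_(t <- s)
    (gauss x * ((t.1 j)%:R * monom (mdec t.1 j) x - x ord0 j * monom t.1 x)) *: t.2.
    apply: clP => A; rewrite mkclE (@derive_val _ _ _ _ _ _ _ (is_derive_gauss_leval s j A x)).
    by rewrite clcoef_sum; apply: eq_bigr => t _; rewrite clcoefZ.
  by rewrite mulr_sumr; apply: eq_bigr => t _; rewrite -scalerAr scalerA.
rewrite exchange_big /=; apply: eq_bigr => t _.
rewrite leval_flatten scaler_sumr big_enum /=; apply: eq_bigr => j _.
rewrite !leval_cons /leval big_nil addr0 /= monom_inc; congr (_ *: _).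
by rewrite scalerBl scalerN !scalerA mulrC.
Qed.

Lemma iter_dirac_gauss s l :
  iter l (@dirac_op R m) (fun y => gauss y *: leval s y) =
  (fun y => gauss y *: leval (iter l hstep s) y).
Proof.
elim: l => //= l IH; rewrite IH; apply/funext => x; exact: dirac_gauss_leval.
Qed.

End HermiteBound.

(** * A weighted l^1 norm adapted to the Gaussian *)

Section HermiteWeight.
Variables (R : realType) (m : nat).
Local Notation Cl := (clifford R m).
Local Notation lpoly := (seq (('I_m -> nat) * Cl)).
Implicit Types (al : 'I_m -> nat) (x : 'rV[R]_m) (s : lpoly).

Definition hweight n : R := Num.sqrt n`!%:R * 2 ^+ n.

Definition lweight s : R := \sum_(t <- s) cl1 t.2 * hweight (mdegf t.1).

Definition ldeg s (d : nat) := forall t, List.In t s -> (mdegf t.1 <= d)%N.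

Lemma hweight_gt0 n : 0 < hweight n.
Proof. by rewrite mulr_gt0 ?exprn_gt0 // sqrtr_gt0 ltr0n fact_gt0. Qed.

Lemma hweightS n : hweight n.+1 = 2 * Num.sqrt n.+1%:R * hweight n.
Proof. by rewrite /hweight factS natrM sqrtrM // exprS; ring. Qed.

Lemma lweight_cat s1 s2 : lweight (s1 ++ s2) = lweight s1 + lweight s2.
Proof. exact: big_cat. Qed.

Lemma lweight_flatten I (r : seq I) (F : I -> lpoly) :
  lweight (flatten [seq F i | i <- r]) = \sum_(i <- r) lweight (F i).
Proof.
elim: r => [|i r IH] /=; first by rewrite /lweight !big_nil.
by rewrite lweight_cat IH big_cons.
Qed.

Lemma lweight_cons t s : lweight (t :: s) = cl1 t.2 * hweight (mdegf t.1) + lweight s.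
Proof. exact: big_cons. Qed.

Lemma hstep_ldeg s d : ldeg s d -> ldeg (hstep s) d.+1.
Proof.
move=> hs u; rewrite /hstep => /List.in_concat[l1 [/List.in_map_iff[t [<- ts]]]].
move=> /List.in_concat[l2 [/List.in_map_iff[j [<- _]]]] /= [<-|[<-|//]] /=.
  rewrite (leq_trans _ (leqW (hs _ ts))) //.
  by apply: leq_sum => i _; rewrite leq_subr.
by rewrite mdegf_inc ltnS hs.
Qed.

(** Raising a degree n costs a weight factor 2 sqrt(n+1). Lowering it multiplies by an exponent at
    most n but gains 2 sqrt(n) in weight, so it costs less than sqrt(d+1). The total is 3 sqrt(d+1)
    in each of the m directions. *)
Lemma hstep_weight s d : ldeg s d ->
  lweight (hstep s) <= 3 * m%:R * Num.sqrt d.+1%:R * lweight s.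
Proof.
elim: s => [|t s IH] hs.
  by rewrite /hstep /lweight /= !big_nil mulr0.
rewrite [hstep _]/(flatten (_ :: _)) /= lweight_cat lweight_cons mulrDr.
apply: lerD; last by apply: IH => u us; apply: hs; right.
have td : (mdegf t.1 <= d)%N by apply: hs; left.
rewrite lweight_flatten big_enum /=.
rewrite (_ : 3 * m%:R * Num.sqrt d.+1%:R * (cl1 t.2 * hweight (mdegf t.1)) =
  \sum_(j < m) 3 * Num.sqrt d.+1%:R * (cl1 t.2 * hweight (mdegf t.1))); last first.
  by rewrite sumr_const card_ord -[RHS]mulr_natl; ring.
apply: ler_sum => j _; rewrite !lweight_cons /lweight big_nil addr0 /=.
set n := mdegf t.1; have wn := hweight_gt0 n.
have c0 := cl1_ge0 t.2.
have cj : cl1 (clgen j * t.2) <= cl1 t.2 by rewrite (le_trans (cl1M _ _)) // cl1_gen mul1r.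
have sd : Num.sqrt n.+1%:R <= Num.sqrt d.+1%:R :> R by rewrite ler_sqrt // ler_nat.
have inc : cl1 (- (clgen j * t.2)) * hweight (mdegf (minc t.1 j)) <=
    2 * Num.sqrt d.+1%:R * (cl1 t.2 * hweight n).
  rewrite mdegf_inc hweightS -scaleN1r cl1Z normrN1 mul1r.
  rewrite (le_trans (ler_wpM2r _ cj)) //.
    by rewrite !mulr_ge0 ?sqrtr_ge0 // ltW.
  rewrite [leLHS](_ : _ = 2 * Num.sqrt n.+1%:R * (cl1 t.2 * hweight n)); last by rewrite -/n; ring.
  have P0 : 0 <= cl1 t.2 * hweight n by rewrite mulr_ge0 // ltW.
  by rewrite ler_wpM2r // ler_wpM2l.
have dec : cl1 ((t.1 j)%:R *: (clgen j * t.2)) * hweight (mdegf (mdec t.1 j)) <=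
    Num.sqrt d.+1%:R * (cl1 t.2 * hweight n).
  have rhs0 : 0 <= Num.sqrt d.+1%:R * (cl1 t.2 * hweight n).
    by rewrite !mulr_ge0 ?sqrtr_ge0 // ltW.
  (* For a zero exponent [mdec] does not lower the degree, but the coefficient vanishes. *)
  have [->|tj] := posnP (t.1 j); first by rewrite scale0r cl10 mul0r.
  rewrite cl1Z normr_nat; have nE : n = _ := mdegf_dec tj.
  set n' := mdegf (mdec t.1 j) in nE *.
  have tn : (t.1 j <= n)%N by rewrite /n /mdegf (bigD1 j) //= leq_addr.
  have w' := hweight_gt0 n'.
  have sn : 0 <= Num.sqrt n'.+1%:R :> R by exact: sqrtr_ge0.
  apply: (@le_trans _ _ (n%:R * cl1 t.2 * hweight n')).
    by rewrite ler_wpM2r ?(ltW w') // ler_pM ?cl1_ge0 // ler_nat.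
  rewrite nE (_ : n'.+1%:R = Num.sqrt n'.+1%:R ^+ 2); last by rewrite sqr_sqrtr.
  rewrite hweightS; have sd' : Num.sqrt n'.+1%:R <= Num.sqrt d.+1%:R :> R.
    by rewrite ler_sqrt // ler_nat -nE -/n leqW.
  rewrite [leLHS](_ : _ = Num.sqrt n'.+1%:R *
    (Num.sqrt n'.+1%:R * cl1 t.2 * hweight n')); last by ring.
  rewrite [leRHS](_ : _ = Num.sqrt d.+1%:R *
    (2 * (Num.sqrt n'.+1%:R * cl1 t.2 * hweight n'))); last by ring.
  have q0 : 0 <= Num.sqrt n'.+1%:R * cl1 t.2 * hweight n' by rewrite !mulr_ge0 // ltW.
  by apply: ler_pM => //; lra.
rewrite (le_trans (lerD dec inc)) // le_eqVlt; apply/orP; left; apply/eqP; ring.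
Qed.

(** After i steps the degree is at most i + k, so the square roots multiply up to sqrt((l+k)!/k!);
    the missing sqrt(k!) is in the initial weight. *)
Lemma iter_hstep_weight s k l : (forall t, List.In t s -> mdegf t.1 = k) ->
  ldeg (iter l (@hstep R m) s) (l + k) /\
  lweight (iter l (@hstep R m) s) <=
    (3 * m%:R) ^+ l * (Num.sqrt (l + k)`!%:R * 2 ^+ k * \sum_(t <- s) cl1 t.2).
Proof.
move=> hs; elim: l => [|l [IHd IHw]].
  split=> [t /hs -> //|]; rewrite /= expr0 mul1r add0n /lweight mulr_sumr.
  elim: s hs => [|t s IH] hs; first by rewrite !big_nil.
  rewrite !big_cons lerD //; last by apply: IH => u us; apply: hs; right.
  have -> : mdegf t.1 = k by apply: hs; left.
  by rewrite mulrC.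
split; first exact: hstep_ldeg.
rewrite iterS (le_trans (hstep_weight IHd)) //.
have c0 : 0 <= 3 * m%:R * Num.sqrt (l + k).+1%:R :> R by rewrite !mulr_ge0 ?sqrtr_ge0.
rewrite (le_trans (ler_wpM2l c0 IHw)) // addSn factS natrM sqrtrM // exprS.
by rewrite le_eqVlt; apply/orP; left; apply/eqP; ring.
Qed.

Lemma coord_le_enorm x j : `|x ord0 j| <= enorm x.
Proof.
rewrite -sqrtr_sqr ler_sqrt; last by apply: sumr_ge0 => i _; exact: sqr_ge0.
by rewrite (bigD1 j) //= lerDl sumr_ge0 // => i _; exact: sqr_ge0.
Qed.

(** Squared, with r the norm and n the degree, this is r^(2n) <= 4^n n! exp(r^2/4), a single term of
    the exponential series at r^2/4; hence the factor [2 ^+ n] in [hweight]. *)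
Lemma monom_le_weight al x :
  `|monom al x| <= hweight (mdegf al) * expR (enorm x ^+ 2 / 8).
Proof.
set n := mdegf al; set r := enorm x.
have r0 : 0 <= r by exact: sqrtr_ge0.
apply: (@le_trans _ _ (r ^+ n)).
  rewrite normr_prod /n /mdegf expr_sum; apply: ler_prod => j _.
  by rewrite normr_ge0 normrX lerXn2r ?nnegrE // coord_le_enorm.
have w0 := hweight_gt0 n.
rewrite -(@ler_pXn2r _ 2) ?nnegrE ?exprn_ge0 ?mulr_ge0 ?expR_ge0 ?(ltW w0) //.
rewrite exprMn -expRM_natl mulr_natl.
have -> : r ^+ 2 / 8 *+ 2 = r ^+ 2 / 4 by field.
rewrite /hweight exprMn sqr_sqrtr //.
have f0 : 0 < n`!%:R :> R by rewrite ltr0n fact_gt0.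
have h : (r ^+ 2 / 4) ^+ n / n`!%:R <= expR (r ^+ 2 / 4).
  by apply: expR_ge_term; rewrite divr_ge0 ?sqr_ge0.
rewrite ler_pdivrMr // exprMn in h.
have -> : (r ^+ n) ^+ 2 = 4 ^+ n * ((r ^+ 2) ^+ n * 4^-1 ^+ n).
  by rewrite mulrCA -exprMn mulfV // expr1n mulr1 -!exprM mulnC.
have -> : (2 ^+ n) ^+ 2 = 4 ^+ n :> R by rewrite -exprM mulnC exprM; congr (_ ^+ _); ring.
by rewrite [n`!%:R * _]mulrC -[leRHS]mulrA ler_wpM2l ?exprn_ge0 // [leRHS]mulrC.
Qed.

Lemma leval_le_weight s x : cl1 (leval s x) <= lweight s * expR (enorm x ^+ 2 / 8).
Proof.
rewrite (le_trans (cl1_sum _ _ _)) // mulr_suml; apply: ler_sum => t _.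
by rewrite cl1Z mulrC -mulrA ler_wpM2l ?cl1_ge0 // monom_le_weight.
Qed.

Lemma mem_In (T : eqType) (y : T) (r : seq T) : List.In y r -> y \in r.
Proof. by elim: r => //= z r IH [->|/IH yr]; rewrite inE ?eqxx // yr orbT. Qed.

Definition lpoly_of (p : mpoly.mpoly m Cl) : lpoly :=
  map (fun a : mpoly.multinom m => ((fun j => a j), mpoly.mcoeff a p)) (mpoly.msupp p).

Lemma leval_lpoly_of p x : leval (lpoly_of p) x = peval p x.
Proof. by rewrite /peval mmap_monom /leval big_map. Qed.

(** The prefactor exp(|x|^2/2) in [hermite] cancels the Gaussian carried through the iterated Dirac
    operator. *)
Lemma phi_eq l k p x : phi l k p x =
  ((Num.sqrt (gamma_lk R m l k))^-1 * expR (- (enorm x ^+ 2 / 4)) * (-1) ^+ l) *: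
     leval (iter l (@hstep R m) (lpoly_of p)) x.
Proof.
rewrite /phi /hermite.
have -> : (fun y => expR (- (enorm y ^+ 2 / 2)) *: peval p y) =
   (fun y => gauss y *: leval (lpoly_of p) y).
  by apply/funext => y; rewrite leval_lpoly_of.
rewrite iter_dirac_gauss !scalerA; congr (_ *: _).
rewrite /gauss -!mulrA; congr (_ * (_ * _)).
by rewrite mulrCA -expRD addrN expR0 mulr1.
Qed.

(** Half of the decay exp(-|x|^2/4) pays for the growth exp(|x|^2/8) of the polynomial. *)
Lemma phi_bound l k p x : p \is mpoly.ishomog1 k (@mpoly.mdeg m) ->
  cl1 (phi l k p x) <= (Num.sqrt (gamma_lk R m l k))^-1 *
   ((3 * m%:R) ^+ l * (Num.sqrt (l + k)`!%:R * 2 ^+ k *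
     \sum_(a <- mpoly.msupp p) cl1 (mpoly.mcoeff a p))) * expR (- (enorm x ^+ 2 / 8)).
Proof.
move=> hp; set r := enorm x; set e8 := expR (- _).
rewrite phi_eq cl1Z -/r; set e4 := expR (- _); set g := _^-1.
have g0 : 0 <= g by rewrite invr_ge0 sqrtr_ge0.
have e40 : 0 <= e4 by exact: expR_ge0.
rewrite !normrM normrX normrN1 expr1n mulr1 (ger0_norm e40) (ger0_norm g0).
rewrite -[leLHS]mulrA -[leRHS]mulrA ler_wpM2l //.
have [|_ hw] := @iter_hstep_weight (lpoly_of p) k l.
  by move=> t /List.in_map_iff[al [<- /mem_In hal]]; exact: (homog_deg hp hal).
rewrite (le_trans (ler_wpM2l e40 (leval_le_weight _ _))) // -/r.
have -> : e8 = e4 * expR (r ^+ 2 / 8) by rewrite /e8 /e4 -expRD; congr expR; field.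
rewrite mulrCA ler_wpM2r ?mulr_ge0 ?expR_ge0 //.
by move: hw; rewrite big_map.
Qed.

Lemma measurable_phi_coef l k p A :
  measurable_fun [set: 'rV[R]_m] (fun x => phi l k p x A).
Proof.
under eq_fun do rewrite phi_eq clcoefZ /leval clcoef_sum.
apply: measurable_funM.
  apply: measurable_funM => //; apply: measurable_funM => //.
  exact: measurable_row_gauss4.
apply: measurable_sum => t; under eq_fun do rewrite clcoefZ.
by apply: measurable_funM => //; exact: measurable_monom.
Qed.

End HermiteWeight.

(** * Inner products with a square integrable function *)

Section InnerBound.
Variables (R : realType) (m : nat).
Local Notation Cl := (clifford R m).
Local Notation lam := (lebesgue_row R m).
Variables (f : 'rV[R]_m -> Cl) (hf : L2 f).

Lemma L2_measurable A : measurable_fun [set: 'rV[R]_m] (fun x => f x A).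
Proof. by have /andP[/set_mem h _] := hf A. Qed.

Lemma cl_mul_coef (a b : Cl) A : (a * b) A =
  \sum_B \sum_C (a B * b C * (-1) ^+ blade_inv B C) * (blade (symdiff B C) : Cl) A.
Proof.
rewrite [a * b]/(clmul a b) clcoef_sum; apply: eq_bigr => B _.
by rewrite clcoef_sum; apply: eq_bigr => C _; rewrite clcoefZ.
Qed.

(** With a = exp(-|x|^2/8) and b = |f_B|, the inequality ab <= a^2 + b^2 bounds the integrand by
    [Q * h], and h is integrable because f is square integrable. The factor [2 ^ m] counts the
    coefficients of the result. *)
Lemma L2_inner_bound : exists2 J : R, 0 <= J &
  forall (g : 'rV[R]_m -> Cl) (Q : R), 0 <= Q ->
  (forall A, measurable_fun [set: 'rV[R]_m] (fun x => g x A)) ->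
  (forall x, cl1 (g x) <= Q * expR (- (enorm x ^+ 2 / 8))) ->
  cl1 (L2_inner g f) <= Q * J.
Proof.
pose h (x : 'rV[R]_m) : R := \sum_(B : {set 'I_m}) (expR (- (enorm x ^+ 2 / 4)) + f x B ^+ 2).
have h0 x : 0 <= h x.
  by apply: sumr_ge0 => B _; rewrite addr_ge0 ?expR_ge0 ?sqr_ge0.
have ih : lam.-integrable setT (EFin \o h).
  have -> : EFin \o h = (fun x => (\sum_(B : {set 'I_m})
      ((expR (- (enorm x ^+ 2 / 4)))%:E + (f x B ^+ 2)%:E))%E).
    by apply/funext => x; rewrite sumEFin.
  apply: integrable_sum => // B _; apply: integrableD => //.
    apply/integrableP; split; first by apply/measurable_EFinP; exact: measurable_row_gauss4.
    under eq_integral do rewrite /= ger0_norm ?expR_ge0 //.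
    exact: integral_row_gauss4_fin.
  exact: Lfun2_integrable_sqr (hf B).
exists ((2 ^ m)%:R * fine (\int[lam]_x (h x)%:E)).
  by rewrite mulr_ge0 // fine_ge0 // integral_ge0 // => x _; rewrite lee_fin.
move=> g Q Q0 mg gQ.
have iQh : lam.-integrable setT (fun x => (Q * h x)%:E).
  by under eq_fun do rewrite EFinM; exact: integrableZl.
have key A : `|L2_inner g f A| <= Q * fine (\int[lam]_x (h x)%:E).
  rewrite mkclE.
  have mcf : measurable_fun [set: 'rV[R]_m] (fun x => (clconj (g x) * f x) A).
    under eq_fun do rewrite cl_mul_coef.
    apply: measurable_sum => B; apply: measurable_sum => C.
    apply: measurable_funM => //; apply: measurable_funM => //.
    apply: measurable_funM; last exact: L2_measurable.
    by under eq_fun do rewrite mkclE; exact: measurable_funM.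
  have le1 x : `|(clconj (g x) * f x) A| <= Q * h x.
    rewrite (le_trans (cl1_coef _ _)) // (le_trans (cl1M _ _)) // cl1_conj.
    rewrite (le_trans (ler_wpM2r (cl1_ge0 _) (gQ x))) // -mulrA ler_wpM2l //.
    rewrite mulr_sumr; apply: ler_sum => B _.
    have -> : expR (- (enorm x ^+ 2 / 4)) = expR (- (enorm x ^+ 2 / 8)) ^+ 2.
      by rewrite -expRM_natl; congr expR; field.
    rewrite -[f x B ^+ 2]real_normK ?num_real //.
    have := sqr_ge0 (expR (- (enorm x ^+ 2 / 8)) - `|f x B|).
    have := sqr_ge0 (expR (- (enorm x ^+ 2 / 8)) + `|f x B|).
    by nra.
  have icf : lam.-integrable setT (fun x => ((clconj (g x) * f x) A)%:E).
    apply: (le_integrable _ _ _ iQh) => //; first exact/measurable_EFinP.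
    by move=> x _; rewrite /= lee_fin (ger0_norm (mulr_ge0 Q0 (h0 x))).
  rewrite (le_trans (le_normr_Rintegral _ icf)) //.
  rewrite -[leRHS](@RintegralZl _ _ _ _ setT h Q) //.
  apply: le_Rintegral => //.
  apply: (le_integrable _ _ _ iQh) => //.
    by apply/measurable_EFinP; exact: measurableT_comp.
  by move=> x _; rewrite /= lee_fin normr_id (ger0_norm (mulr_ge0 Q0 (h0 x))).
rewrite (@le_trans _ _ (\sum_(A : {set 'I_m}) Q * fine (\int[lam]_x (h x)%:E))) //.
  by apply: ler_sum => A _; exact: key.
rewrite sumr_const -finset.cardsT -finset.powersetT card_powerset finset.cardsT card_ord.
by rewrite -[leLHS]mulr_natl mulrCA.
Qed.

End InnerBound.

(** * The normalising constants *)

Section GammaBound.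
Variable R : realType.

Lemma leq_fact_exp n : (n`! <= n.+1 ^ n)%N.
Proof.
elim: n => // n IH; rewrite factS expnS leq_mul // (leq_trans IH) //.
by case: n {IH} => // n; rewrite leq_exp2r.
Qed.

Let c : R := expR (- 1) / 2.

(* The first alternative covers the junk value 0 of a divergent integral; gamma_lk
   then vanishes and so does Psi, since 0^-1 = 0. *)
Lemma Gamma_lower (n : nat) (s : R) : n%:R <= s ->
  Gamma s = 0 \/ n`!%:R * c ^+ n.+2 <= Gamma s.
Proof.
move=> ns; set B := _ * _.
have B0 : 0 <= B by rewrite mulr_ge0 // exprn_ge0 // divr_ge0 ?expR_ge0.
pose g (t : measurableTypeR R) : \bar R := (t `^ (s - 1) * expR (- t))%:E.
have mg : measurable_fun setT g.
  apply/measurable_EFinP; apply: measurable_funM; first exact: measurable_powR.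
  by apply: measurableT_comp => //; exact: measurableT_comp.
have g0 t : (0 <= g t)%E by rewrite lee_fin mulr_ge0 ?powR_ge0 ?expR_ge0.
(* On this interval of length 1, t^(s-1) >= t^n / t >= n! / 2^(n+2), since t <= n+2 <= 2^(n+2), and
   exp(-t) >= exp(-(n+2)); the product is B. *)
pose D : set (measurableTypeR R) := `[n.+1%:R, n.+2%:R]%classic.
pose E : set (measurableTypeR R) := `]0, +oo[%classic.
have mD : measurable D by exact: measurable_itv.
have mE : measurable E by exact: measurable_itv.
have gB t : D t -> (B%:E <= g t)%E.
  rewrite /D /= in_itv /= => /andP[t1 t2]; rewrite lee_fin.
  have t0 : 0 < t by apply: lt_le_trans t1; rewrite ltr0n.
  have BE : B = n`!%:R / 2 ^+ n.+2 * expR (- n.+2%:R).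
    by rewrite /B /c exprMn -expRM_natl exprVn mulrN1 mulrCA mulrC.
  rewrite BE ler_pM ?expR_ge0 ?divr_ge0 ?exprn_ge0 //; last by rewrite ler_expR lerN2.
  apply: (@le_trans _ _ (t ^+ n / t)).
    rewrite ler_pM ?invr_ge0 ?exprn_ge0 //.
      apply: (@le_trans _ _ (n.+1%:R ^+ n)); first by rewrite -natrX ler_nat leq_fact_exp.
      by rewrite lerXn2r ?nnegrE ?(ltW t0).
    rewrite lef_pV2 ?posrE ?exprn_gt0 // (le_trans t2) // -natrX ler_nat.
    exact/ltnW/ltn_expl.
  have -> : t ^+ n / t = t `^ (n%:R - 1).
    by rewrite powRB ?(gt_eqF t0) ?implybT // powR_mulrn ?(ltW t0) // powRr1 ?(ltW t0).
  apply: ler_powR; last by rewrite lerD2r.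
  by apply: le_trans t1; rewrite ler1n.
have hI : (B%:E <= \int[lebesgue_measure]_(t in E) g t)%E.
  apply: (@le_trans _ _ (\int[lebesgue_measure]_(t in D) g t)%E).
    apply: (@le_trans _ _ (\int[lebesgue_measure]_(t in D) B%:E)%E).
      rewrite (integral_cst (@lebesgue_measure R) mD)
        [X in (_ * X)%E](lebesgue_measure_itv `[n.+1%:R, n.+2%:R]).
      by rewrite /= lte_fin ltr_nat ltnSn -EFinB -[n.+2]addn1 natrD addrAC subrr add0r mule1.
    by apply: ge0_le_integral => //; exact: measurable_funTS.
  apply: ge0_subset_integral => //; first exact: measurable_funTS.
  move=> t; rewrite /D /E /= !in_itv /= andbT => /andP[t1 _].
  by apply: lt_le_trans t1; rewrite ltr0n.
rewrite /Gamma /Rintegral; move: hI; rewrite -/E -/g.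
by case: (\int[lebesgue_measure]_(t in E) g t)%E => [r| |] //=; [right|left].
Qed.

Lemma Gamma_ge0 (s : R) : 0 <= Gamma s.
Proof. by apply: Rintegral_ge0 => t _; rewrite mulr_ge0 ?powR_ge0 ?expR_ge0. Qed.

(** In both parities the argument of the Gamma function in the numerator is [uphalf l + k] plus m/2,
    so [Gamma_lower] applies; the powers of 2 and of pi are at least 1 and are dropped. *)
Lemma gamma_lk_lower (m : nat) : exists2 C : R, 1 <= C & forall l k : nat,
  gamma_lk R m l k = 0 \/
  (0 < gamma_lk R m l k /\
   (l./2)`!%:R * (uphalf l + k)`!%:R <= C ^+ (l + k).+1 * gamma_lk R m l k).
Proof.
pose G : R := Gamma (m%:R / 2).
have c0 : 0 < c by rewrite divr_gt0 ?expR_gt0.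
have c1 : 1 <= c^-1.
  have e1 : expR (- 1) <= 1 :> R by rewrite -expR0 ler_expR oppr_le0.
  by rewrite invf_ge1 // /c; lra.
have G0 : 0 <= G := Gamma_ge0 _.
(* [1 + G] absorbs the denominator Gamma(m/2), and the square suffices since n + 2 <= 2 (l + k +
   1). *)
exists ((1 + G) * c^-1 ^+ 2).
  by rewrite mulr_ege1 ?exprn_ege1 // lerDl.
move=> l k; set n := (uphalf l + k)%N; set gam := gamma_lk R m l k.
have [s [b [ns b1 gE]]] : exists s b : R, [/\ n%:R <= s, 1 <= b &
    gam = b * (l./2)`!%:R * Gamma s / G].
  have pi1 : 1 <= Num.sqrt pi ^+ m :> R.
    rewrite exprn_ege1 // -(sqrtr1 R) ler_sqrt ?pi_ge0 //.
    by rewrite (le_trans _ (pi_ge2 R)) // ler1n.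
  have m0 : 0 <= m%:R / 2 :> R by rewrite divr_ge0.
  have pw (r : R) : 0 <= r -> 1 <= 2 `^ r.
    by move=> r0; rewrite -[leLHS](powRr0 2) ler_powR // ler1n.
  have hl := odd_double_half l.
  rewrite /gam /gamma_lk; case: ifP => odl; rewrite odl in hl.
    exists (m%:R / 2 + k%:R + (l./2)%:R + 1),
      (2 `^ ((2 * l./2)%:R + m%:R / 2 + k%:R + 1) * Num.sqrt pi ^+ m).
    split; last by congr (_ * _ / _); rewrite mulrAC.
      have -> : n%:R = k%:R + (l./2)%:R + 1 :> R.
        by rewrite /n uphalf_half odl add1n addSn -addn1 !natrD; ring.
      by rewrite -!addrA lerDr.
    by rewrite mulr_ege1 // pw // !addr_ge0.
  exists (m%:R / 2 + k%:R + (l./2)%:R), (2 `^ ((2 * l./2)%:R + m%:R / 2 + k%:R) * Num.sqrt pi ^+ m).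
  split; last by congr (_ * _ / _); rewrite mulrAC.
    have -> : n%:R = k%:R + (l./2)%:R :> R.
      by rewrite /n uphalf_half odl add0n natrD addrC.
    by rewrite -!addrA lerDr.
  by rewrite mulr_ege1 // pw // !addr_ge0.
have [G00|Gn0] := eqVneq G 0; first by left; rewrite gE G00 invr0 mulr0.
have Gp : 0 < G by rewrite lt_def Gn0.
have [Gs|hG] := Gamma_lower ns; first by left; rewrite gE Gs mulr0 mul0r.
right; move: hG gE; set s' := Gamma s => hG gE.
have f0 j : 0 < j`!%:R :> R by rewrite ltr0n fact_gt0.
have cn : 0 < c ^+ n.+2 by rewrite exprn_gt0.
have s0 : 0 < s' by apply: lt_le_trans hG; rewrite mulr_gt0.
have b0 : 0 < b by exact: lt_le_trans b1.
have gp : 0 < gam by rewrite gE !mulr_gt0 // invr_gt0.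
split=> //.
have h1 : (l./2)`!%:R * n`!%:R <= G * c^-1 ^+ n.+2 * gam.
  rewrite gE [leRHS](_ : _ = (l./2)`!%:R * (b * (s' * c^-1 ^+ n.+2))); last by field.
  rewrite ler_wpM2l // exprVn.
  have h2 : n`!%:R <= s' / c ^+ n.+2 by rewrite ler_pdivlMr.
  by rewrite (le_trans h2) // ler_peMl // ltW // divr_gt0.
rewrite (le_trans h1) // ler_wpM2r ?(ltW gp) // exprMn -exprM.
apply: ler_pM; rewrite ?exprn_ge0 ?invr_ge0 ?(ltW c0) //.
  by rewrite (@le_trans _ _ (1 + G)) ?lerDr // ler_eXnr // lerDl.
rewrite ler_weXn2l // /n.
have : (uphalf l <= l)%N by rewrite -{2}(odd_double_half l) uphalf_half leq_add2l -addnn leq_addr.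
move=> ul; rewrite mul2n -addnn addSn addnS !ltnS.
by rewrite (@leq_trans (l + k)) ?leq_add2r // leq_addr.
Qed.

Lemma fact_le_split (p q : nat) : (p + q)`!%:R <= 2 ^+ (p + q) * (p`!%:R * q`!%:R) :> R.
Proof.
rewrite -natrX -!natrM ler_nat -(@bin_fact (p + q) p) ?leq_addr // addKn.
by rewrite leq_mul2r leq_bin_exp2 orbT.
Qed.

(** Squared, this is [expR_ge_term] at y^2 with a spare factor exp(y^2). It lets square roots of
    factorials beat every geometric growth. *)
Lemma pow_le_sqrt_fact (y : R) n : 0 <= y -> y ^+ n <= expR (y ^+ 2) * Num.sqrt n`!%:R.
Proof.
move=> y0; have f0 : 0 < n`!%:R :> R by rewrite ltr0n fact_gt0.
have e1 : 1 <= expR (y ^+ 2) by rewrite -expR0 ler_expR sqr_ge0.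
rewrite -(@ler_pXn2r _ 2) ?nnegrE ?exprn_ge0 ?mulr_ge0 ?expR_ge0 ?sqrtr_ge0 //.
rewrite exprMn sqr_sqrtr ?(ltW f0) // -exprM mulnC exprM -ler_pdivrMr //.
rewrite (le_trans (expR_ge_term n (sqr_ge0 y))) // expr2.
by rewrite ler_peMl ?expR_ge0.
Qed.

End GammaBound.

(** * Summation *)

Section SeriesTerms.
Variables (R : realType) (m : nat).

(** Near each point x the bound 1 + |x_1| + ... + |x_m| holds for every coordinate, hence all large
    n work; near-covering compactness yields one N for all of K. *)
Lemma compact_coord_bounded (K : set 'rV[R[i]]_m) : compact K ->
  exists2 r : R, 1 <= r & forall z, K z -> \sum_j `|z ord0 j| <= r%:C%C.
Proof.
move=> /compact_near_coveringP hK.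
have := hK nat \oo (fun n (z : 'rV[R[i]]_m) => forall j, `|z ord0 j| <= (n%:R : R)%:C%C) _.
case.
  move=> x _; pose b : R := 1 + \sum_j Normc.normc (x ord0 j).
  have n0 (w : R[i]) : 0 <= Normc.normc w by case: w => u v; exact: sqrtr_ge0.
  exists ([set y : 'rV[R[i]]_m | forall j, `|x ord0 j - y ord0 j| < 1],
          [set n : nat | b <= n%:R]); last first.
    move=> [y n] [/= hy hn] j.
    have -> : y ord0 j = x ord0 j - (x ord0 j - y ord0 j) by ring.
    rewrite (le_trans (ler_normB _ _)) // (@le_trans _ _ b%:C%C) ?lecR //.
    rewrite /b addrC rmorphD /= lerD // ?(ltW (hy j)) // rmorph_sum /= (bigD1 j) //=.
    have -> : `|x ord0 j| = (Normc.normc (x ord0 j))%:C%C by case: (x ord0 j).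
    by rewrite lerDl sumr_ge0 // => i _; rewrite ler0c.
  split=> /=.
    suff : \forall y \near (x : 'rV[R[i]]_m), forall j : 'I_m,
        `|x ord0 j - (y : 'rV[R[i]]_m) ord0 j| < 1 by [].
    have FF : Filter (nbhs x) := nbhs_filter x.
    refine (@filter_forall _ _ (fun (j : 'I_m) =>
      [set y : 'rV[R[i]]_m | `|x ord0 j - y ord0 j| < 1]) (nbhs x) FF _) => j.
    have cx : (fun y : 'rV[R[i]]_m => y ord0 j) y @[y --> x] --> x ord0 j.
      exact: coord_continuous.
    by move/cvgr_dist_lt : cx; apply.
  exact: nbhs_infty_ger.
move=> N _ hN; exists (1 + m%:R * N%:R); first by rewrite lerDl mulr_ge0.
move=> z Kz; have hz := hN N (leqnn N) z Kz.
rewrite (@le_trans _ _ (\sum_(j < m) (N%:R : R)%:C%C)) //; first by apply: ler_sum.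
by rewrite sumr_const card_ord -[leLHS]mulr_natl
  -(rmorph_nat (real_complex R) m) -rmorphM /= lecR lerDr.
Qed.


Lemma pevalC_bound k (p : mpoly.mpoly m (clifford R m)) (z : 'rV[R[i]]_m) (r : R) :
  p \is mpoly.ishomog1 k (@mpoly.mdeg m) -> \sum_j `|z ord0 j| <= r%:C%C ->
  cl1 (pevalC p z) <= (r ^+ k * \sum_(al <- mpoly.msupp p) cl1 (mpoly.mcoeff al p))%:C%C.
Proof.
move=> hp hz; rewrite /pevalC mmap_monom (le_trans (cl1_sum _ _ _)) //.
rewrite mulr_sumr rmorph_sum big_seq [leRHS]big_seq; apply: ler_sum => al hal.
rewrite cl1Z cl1_complex rmorphM /= ler_wpM2r ?ler0c ?cl1_ge0 //.
rewrite rmorphXn /= -(homog_deg hp hal) /monom normr_prod expr_sum.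
apply: ler_prod => j _; rewrite normr_ge0 normrX.
have zj : `|z ord0 j| <= r%:C%C.
  by rewrite (le_trans _ hz) // (bigD1 j) //= lerDl sumr_ge0.
by rewrite lerXn2r ?nnegrE // (le_trans _ zj).
Qed.

Lemma Psi_bound l k (p : mpoly.mpoly m (clifford R m)) (z : 'rV[R[i]]_m) (r : R) :
  p \is mpoly.ishomog1 k (@mpoly.mdeg m) -> \sum_j `|z ord0 j| <= r%:C%C ->
  cl1 (Psi l k p z) <= ((Num.sqrt (gamma_lk R m l k))^-1 *
    (r ^+ l * (r ^+ k * \sum_(al <- mpoly.msupp p) cl1 (mpoly.mcoeff al p))))%:C%C.
Proof.
move=> hp hz; set g := _^-1.
have g0 : 0 <= g by rewrite invr_ge0 sqrtr_ge0.
have r0 : 0 <= r by rewrite -ler0c (le_trans _ hz) // sumr_ge0.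
rewrite cl1Z ger0_norm ?ler0c // rmorphM /= ler_wpM2l ?ler0c //.
rewrite (le_trans (cl1M _ _)) // rmorphM /= ler_pM ?cl1_ge0 ?pevalC_bound //.
rewrite (le_trans (cl1X _ _)) // rmorphXn /= lerXn2r ?nnegrE ?cl1_ge0 ?ler0c //.
exact: le_trans (cl1_clvec _) hz.
Qed.

Lemma dim_monogenic_le k : (0 < m)%N -> (dim_monogenic m k <= 2 ^ (m + k))%N.
Proof.
move=> hm; rewrite /dim_monogenic; case: ifP => _; first by rewrite expn_gt0.
by rewrite (leq_trans (leq_bin_exp2 _ _)) // leq_exp2l // leq_subr.
Qed.

End SeriesTerms.

(** * Absorbing geometric growth into factorials *)

Section Numeric.
Variable R : realType.

(** Since p + q = l + k, [fact_le_split] bounds the square root of (l+k)! by a geometric factor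
    times that of p! q!, so the quotient by gam decays like 1/sqrt(p! q!), at most 1/sqrt(p! k!). E
    collects all geometric growth, and the additional 2 in Y buys the decay 2^(-l-k). *)
Lemma geometric_absorb (A C D : R) (l k : nat) : 0 <= A -> 1 <= C -> 1 <= D ->
  forall gam : R, 0 < gam ->
  (l./2)`!%:R * (uphalf l + k)`!%:R <= D ^+ (l + k).+1 * gam ->
  A * C ^+ (l + k).+1 * (gam^-1 * Num.sqrt (l + k)`!%:R) <=
  A * (C * D * 2) * (2 * (C * D * 2)) * expR ((2 * (C * D * 2)) ^+ 4) *
    expR ((2 * (C * D * 2)) ^+ 2) / 2 ^+ l / 2 ^+ k.
Proof.
move=> A0 C1 D1 gam gam0 hg; set p := l./2 in hg *; set q := (uphalf l + k)%N in hg *.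
pose E := C * D * 2; rewrite -/E; pose Y := 2 * E; rewrite -/Y.
have lk : (l + k = p + q)%N.
  by rewrite -{1}(odd_double_half l) /q uphalf_half -/p -addnn; ring.
have f0 n : 0 < n`!%:R :> R by rewrite ltr0n fact_gt0.
have C0 : 0 < C by exact: lt_le_trans C1.
have D0 : 0 < D by exact: lt_le_trans D1.
have E1 : 1 <= E by rewrite /E mulr_ege1 ?ler1n // mulr_ege1.
have Y1 : 1 <= Y by rewrite /Y mulr_ege1 // ler1n.
have Y0 : 0 < Y by exact: lt_le_trans Y1.
set X := p`!%:R * q`!%:R in hg.
have X0 : 0 < X by rewrite mulr_gt0.
have sX : 0 < Num.sqrt X by rewrite sqrtr_gt0.
have h1 : gam^-1 <= D ^+ (l + k).+1 / X.
  by rewrite ler_pdivlMr // mulrC ler_pdivrMr.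
have h2 : Num.sqrt (l + k)`!%:R <= 2 ^+ (l + k).+1 * Num.sqrt X.
  rewrite -(@ler_pXn2r _ 2) ?nnegrE ?mulr_ge0 ?exprn_ge0 ?sqrtr_ge0 //.
  rewrite exprMn !sqr_sqrtr ?(ltW X0) // lk (le_trans (fact_le_split R p q)) //.
  rewrite ler_wpM2r ?(ltW X0) // -exprM ler_weXn2l ?ler1n //.
  by rewrite muln2 -addnn leqW // leq_addr.
have h3 : gam^-1 * Num.sqrt (l + k)`!%:R <= D ^+ (l + k).+1 * 2 ^+ (l + k).+1 / Num.sqrt X.
  rewrite (@le_trans _ _ (D ^+ (l + k).+1 / X * (2 ^+ (l + k).+1 * Num.sqrt X))) //.
    by rewrite ler_pM ?invr_ge0 ?sqrtr_ge0 // ltW.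
  rewrite -{1}[X]sqr_sqrtr ?(ltW X0) // le_eqVlt; apply/orP; left; apply/eqP.
  by field; rewrite gt_eqF.
have kX : Num.sqrt p`!%:R * Num.sqrt k`!%:R <= Num.sqrt X.
  rewrite -sqrtrM ?(ltW (f0 _)) // ler_sqrt ?(ltW X0) // /X ler_pM2l // ler_nat.
  by rewrite leq_fact // leq_addl.
(* Here l <= 2p + 1, and [pow_le_sqrt_fact] is applied to Y^2 with exponent p; hence Y^4 in the
   exponential. *)
have Yl : Y ^+ l <= Y * (expR (Y ^+ 4) * Num.sqrt p`!%:R).
  rewrite (@le_trans _ _ (Y ^+ (p.*2).+1)) //.
    rewrite ler_weXn2l // -{1}(odd_double_half l) -/p -add1n leq_add2r.
    by case: (odd l).
  rewrite exprS -muln2 mulnC exprM ler_wpM2l ?(ltW Y0) //.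
  rewrite (le_trans (pow_le_sqrt_fact p (sqr_ge0 Y))) //.
  by rewrite -exprM.
have Yk : Y ^+ k <= expR (Y ^+ 2) * Num.sqrt k`!%:R by exact: pow_le_sqrt_fact (ltW Y0).
have e4 := expR_ge0 (Y ^+ 4); have e2 := expR_ge0 (Y ^+ 2).
have YY : Y ^+ l * Y ^+ k <= Y * expR (Y ^+ 4) * expR (Y ^+ 2) * Num.sqrt X.
  rewrite (le_trans (ler_pM (exprn_ge0 _ (ltW Y0)) (exprn_ge0 _ (ltW Y0)) Yl Yk)) //.
  rewrite [leLHS](_ : _ = Y * expR (Y ^+ 4) * expR (Y ^+ 2) *
    (Num.sqrt p`!%:R * Num.sqrt k`!%:R)); last by ring.
  by rewrite ler_wpM2l // !mulr_ge0 // ltW.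
have AC : 0 <= A * C ^+ (l + k).+1 by rewrite mulr_ge0 // exprn_ge0 // ltW.
rewrite (le_trans (ler_wpM2l AC h3)) //.
rewrite ler_pdivlMr ?exprn_gt0 // ler_pdivlMr ?exprn_gt0 //.
rewrite [leLHS](_ : _ = A * E * (Y ^+ l * Y ^+ k) / Num.sqrt X).
  rewrite ler_pdivrMr //.
  rewrite [leRHS](_ : _ = A * E * (Y * expR (Y ^+ 4) * expR (Y ^+ 2) * Num.sqrt X)).
    by rewrite ler_wpM2l // mulr_ge0 // (le_trans _ E1).
  by ring.
have yE i : Y ^+ i = 2 ^+ i * (C ^+ i * D ^+ i * 2 ^+ i) by rewrite -!exprMn.
rewrite !yE !exprS !exprD /E; field.
by rewrite gt_eqF.
Qed.

End Numeric.

(** The coefficient norm of the basis polynomial enters through both [Psi] and [phi], whence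
    [C1 ^+ 2], and the two normalisations give 1/gamma. The last 2 in C and the [2 ^ m] in A count
    the indices j, of which there are at most [2 ^ (m + k)]. *)
Lemma term_bound (R : realType) (m : nat) (hm : (0 < m)%N)
    (P : forall k : nat, 'I_(dim_monogenic m k) -> mpoly.mpoly m (clifford R m))
    (hP : forall k : nat, orthonormal_basis (P k))
    (f : 'rV[R]_m -> clifford R m) (hf : L2 f) (r : R) : 1 <= r ->
  exists M : R, forall (l k : nat) (z : 'rV[R[i]]_m),
  \sum_j `|z ord0 j| <= r%:C%C ->
  cl1 (\sum_(j < dim_monogenic m k)
         Psi l k (P k j) z * cl_complex (L2_inner (phi l k (P k j)) f)) <=
  (M / 2 ^+ l / 2 ^+ k)%:C%C.
Proof.
move=> r1; have [C1 C11 hC1] := coef_l1_bound R hm.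
have [C2 C21 hC2] := gamma_lk_lower R m; have [J J0 hJ] := L2_inner_bound hf.
pose A := J * 2 ^+ m; pose C := r * (3 * m%:R) * 2 * C1 ^+ 2 * 2.
have A0 : 0 <= A by rewrite mulr_ge0 // exprn_ge0.
have m1 : 1 <= 3 * m%:R :> R by rewrite -natrM ler1n muln_gt0.
have C1' : 1 <= C by rewrite /C !mulr_ege1 ?exprn_ege1 ?ler1n.
exists (A * (C * C2 * 2) * (2 * (C * C2 * 2)) * expR ((2 * (C * C2 * 2)) ^+ 4) *
    expR ((2 * (C * C2 * 2)) ^+ 2)) => l k z hz.
set n := (l + k).+1; set gam := gamma_lk R m l k.
pose g := (Num.sqrt gam)^-1.
have g0 : 0 <= g by rewrite invr_ge0 sqrtr_ge0.
pose S := r ^+ n * (3 * m%:R) ^+ n * 2 ^+ n * (C1 ^+ 2) ^+ n.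
have r0 : 0 <= r by exact: le_trans r1.
have term (j : 'I_(dim_monogenic m k)) :
    cl1 (Psi l k (P k j) z * cl_complex (L2_inner (phi l k (P k j)) f)) <=
    (J * S * (g ^+ 2 * Num.sqrt (l + k)`!%:R))%:C%C.
  have [hmon hort _] := hP k; have [hom _] := hmon j.
  have hL : sphere_inner (peval (P k j)) (peval (P k j)) = 1 by rewrite hort eqxx.
  have := hC1 k (P k j) hom hL; set L := \sum_(al <- _) _ => LC.
  have L0 : 0 <= L by apply: sumr_ge0 => al _; exact: cl1_ge0.
  have hPsi := Psi_bound l hom hz; rewrite -/L -/gam -/g in hPsi.
  have hphi x := phi_bound l x hom; rewrite -/L -/gam -/g in hphi.
  pose Q := g * ((3 * m%:R) ^+ l * (Num.sqrt (l + k)`!%:R * 2 ^+ k * L)).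
  have s0 : 0 <= Num.sqrt (l + k)`!%:R :> R by exact: sqrtr_ge0.
  have Q0 : 0 <= Q by rewrite /Q !mulr_ge0 ?exprn_ge0.
  have hin := hJ _ Q Q0 (@measurable_phi_coef R m l k (P k j)) hphi.
  rewrite (le_trans (cl1M _ _)) // cl1_complex.
  apply: (@le_trans _ _ ((g * (r ^+ l * (r ^+ k * L)))%:C%C * (Q * J)%:C%C)).
    by rewrite ler_pM ?cl1_ge0 ?ler0c ?cl1_ge0 ?lecR.
  rewrite -rmorphM /= lecR /Q.
  rewrite [leLHS](_ : _ = J * (r ^+ (l + k) * (3 * m%:R) ^+ l * 2 ^+ k * L ^+ 2) *
      (g ^+ 2 * Num.sqrt (l + k)`!%:R)); last by rewrite exprD; ring.
  rewrite ler_wpM2r ?mulr_ge0 ?exprn_ge0 // ler_wpM2l //.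
  (* All bases are at least 1, so the exponents l, k and l + k are raised to the common n. *)
  have up (a : R) i : 1 <= a -> (i <= n)%N -> a ^+ i <= a ^+ n.
    by move=> a1 hi; rewrite ler_weXn2l.
  have L2 : L ^+ 2 <= (C1 ^+ 2) ^+ n.
    rewrite -exprM mulnC exprM lerXn2r ?nnegrE ?exprn_ge0 ?(le_trans _ C11) //.
    by rewrite (le_trans LC) // up // ltnS leq_addl.
  have p1 : 0 <= (3 * m%:R : R) by exact: le_trans m1.
  apply: ler_pM; rewrite ?mulr_ge0 ?exprn_ge0 //.
  apply: ler_pM; rewrite ?mulr_ge0 ?exprn_ge0 //; last first.
    by rewrite up ?ler1n // leqW // leq_addl.
  apply: ler_pM; rewrite ?mulr_ge0 ?exprn_ge0 // ?up //.
  by rewrite leqW // leq_addr.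
have S0 : 0 <= S by rewrite !mulr_ge0 ?exprn_ge0 // (le_trans _ C11).
have total : cl1 (\sum_(j < dim_monogenic m k)
         Psi l k (P k j) z * cl_complex (L2_inner (phi l k (P k j)) f)) <=
    (A * C ^+ n * (g ^+ 2 * Num.sqrt (l + k)`!%:R))%:C%C.
  rewrite (le_trans (cl1_sum _ _ _)) //.
  apply: (@le_trans _ _ (\sum_(j < dim_monogenic m k)
     (J * S * (g ^+ 2 * Num.sqrt (l + k)`!%:R))%:C%C)).
    by apply: ler_sum => j _; exact: term.
  rewrite sumr_const card_ord -rmorphMn /= lecR -[leLHS]mulr_natl.
  set T := g ^+ 2 * _; have T0 : 0 <= T by rewrite mulr_ge0 ?exprn_ge0 ?sqrtr_ge0.
  rewrite mulrA ler_wpM2r //.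
  have -> : A * C ^+ n = 2 ^+ m * 2 ^+ n * (J * S) by rewrite /A /C /S !exprMn; ring.
  have JS0 : 0 <= J * S by exact: mulr_ge0.
  rewrite ler_wpM2r // -exprD -natrX ler_nat.
  rewrite (leq_trans (dim_monogenic_le k hm)) // leq_exp2l //.
  by rewrite leq_add2l leqW // leq_addl.
apply: (le_trans total); rewrite lecR.
(* If gamma has the junk value 0, then g = 0 and the left side vanishes. *)
have [gam0|[gam0 hg]] := hC2 l k.
  rewrite /g /gam gam0 sqrtr0 invr0 expr0n mul0r mulr0.
  have C10 : 0 <= C1 by exact: le_trans C11.
  have C20 : 0 <= C2 by exact: le_trans C21.
  by rewrite !mulr_ge0 ?invr_ge0 ?exprn_ge0 ?expR_ge0.
have -> : g ^+ 2 = gam^-1 by rewrite /g exprVn sqr_sqrtr // ltW.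
exact: geometric_absorb.
Qed.

Theorem proposition6p3 (R : realType) (m : nat) (hm : (0 < m)%N)
    (P : forall k : nat, 'I_(dim_monogenic m k) -> mpoly.mpoly m (clifford R m))
    (hP : forall k : nat, orthonormal_basis (P k))
    (f : 'rV[R]_m -> clifford R m) (hf : L2 f)
    (K : set 'rV[R[i]]_m) (hK : compact K) :
  exists F : 'rV[R[i]]_m -> clifford R[i] m,
    (forall z, K z ->
      has_iterated_sum
        (fun l k : nat => \sum_(j < dim_monogenic m k)
           Psi l k (P k j) z * cl_complex (L2_inner (phi l k (P k j)) f))
        (F z)) /\
    (ereal_sup [set (clnorm (F z))%:E | z in K] < +oo)%E.
Proof.
have [r r1 hr] := compact_coord_bounded hK.
have [M hM] := term_bound hm hP hf r1.
(* The constant of [clifford_series_geometric], which is used twice: summing over k leaves c M /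
   2^l, and summing over l gives c (c M), independent of z. *)
pose c : R := 2 ^+ (2 ^ m) * 4.
have hF z : K z -> exists s, has_iterated_sum
        (fun l k : nat => \sum_(j < dim_monogenic m k)
           Psi l k (P k j) z * cl_complex (L2_inner (phi l k (P k j)) f)) s /\
    cl1 s <= (c * (c * M))%:C%C.
  move=> Kz.
  have /choice[t ht] l := clifford_series_geometric (fun k => hM l k z (hr z Kz)).
  have [|s [s1 s2]] := @clifford_series_geometric R m t (c * M).
    by move=> l; have [_] := ht l; rewrite -/c mulrA.
  by exists s; split=> //; exists t; split=> // l; have [] := ht l.
have /choice[F hF'] z : exists s, K z -> has_iterated_sum
        (fun l k : nat => \sum_(j < dim_monogenic m k)
           Psi l k (P k j) z * cl_complex (L2_inner (phi l k (P k j)) f)) s /\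
    cl1 s <= (c * (c * M))%:C%C.
  (* Choice needs a value at every z; outside K any one will do. *)
  have [Kz|nKz] := pselect (K z); last by exists 0.
  by have [s hs] := hF z Kz; exists s.
exists F; split=> [z Kz|]; first by have [] := hF' z Kz.
apply: (@le_lt_trans _ _ (c * (c * M))%:E); last exact: ltry.
apply: ge_ereal_sup => _ [z Kz <-]; rewrite lee_fin.
by apply: clnorm_le; have [] := hF' z Kz.
Qed.
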